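(* Let $\mathcal{H}_A,\mathcal{H}_B$ be finite-dimensional Hilbert spaces and $t\in\mathbb{R}$, $\delta>0$. There is a quantum protocol, fixed independently of the unknown states, which on input $\sigma_{AB}\otimes\rho_{A_1}\otimes\cdots\otimes\rho_{A_n}$, where $\rho\in\mathcal{D}(\mathcal{H}_A)$ and $\sigma_{AB}\in\mathcal{D}(\mathcal{H}_A\otimes\mathcal{H}_B)$ are arbitrary unknown states, outputs a state $\tilde\sigma_{AB}$ satisfying $$\tfrac12\big\|(e^{-i\rho t}\otimes \mathbb{1}_B)\,\sigma_{AB}\,(e^{i\rho t}\otimes\mathbb{1}_B)-\tilde\sigma_{AB}\big\|_1\le\delta,$$ provided $n=O(t^2/\delta)$, where the constant in $O(\cdot)$ is independent of $\dim\mathcal{H}_A$, $\dim\mathcal{H}_B$, $\rho$, $\sigma$. In other words, $e^{-i\rho t}$ can be implemented to error $\delta$ in diamond norm using $O(t^2/\delta)$ copies of $\rho$.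
   Context: $\mathcal{D}(\mathcal{H})$ denotes the set of density operators (positive semidefinite, trace one) on $\mathcal{H}$. $\|A\|_1=\operatorname{Tr}\sqrt{AA^\dagger}$. For channels $\mathcal{E}_1,\mathcal{E}_2$ on $\mathcal{D}(\mathcal{H})$, the diamond norm is $\|\mathcal{E}_1-\mathcal{E}_2\|_\diamond=\max_{k,\rho\in\mathcal{D}(\mathcal{H}\otimes\mathcal{H}_k)}\|(\mathcal{E}_1\otimes\mathcal{I})(\rho)-(\mathcal{E}_2\otimes\mathcal{I})(\rho)\|_1$, and ''implementing a unitary $U$ to error $\delta$ in diamond norm'' means the implemented channel $\mathcal{E}$ satisfies $\tfrac12\|\mathcal{E}-U(\cdot)U^\dagger\|_\diamond\le\delta$. *)

(* Defs.v *)
From Stdlib Require Import Reals Lra List Arith.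
Open Scope R_scope.

Record C := mkC { re : R; im : R }.
Definition C0 : C := mkC 0 0.
Definition C1 : C := mkC 1 0.
Definition Cadd (x y : C) : C := mkC (re x + re y) (im x + im y).
Definition Copp (x : C) : C := mkC (- re x) (- im x).
Definition Cmul (x y : C) : C :=
  mkC (re x * re y - im x * im y) (re x * im y + im x * re y).
Definition Cconj (x : C) : C := mkC (re x) (- im x).

Fixpoint Csum (d : nat) (f : nat -> C) : C :=
  match d with O => C0 | S d' => Cadd (Csum d' f) (f d') end.

(** * Matrices: functions on indices; dimensions are passed separately,
      entries outside the range are irrelevant. Indices start at 0. *)
Definition Mat := nat -> nat -> C.

Definition Mid : Mat := fun i j => if Nat.eqb i j then C1 else C0.
Definition Madd (A B : Mat) : Mat := fun i j => Cadd (A i j) (B i j).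
Definition Msub (A B : Mat) : Mat := fun i j => Cadd (A i j) (Copp (B i j)).
Definition Mscale (c : C) (A : Mat) : Mat := fun i j => Cmul c (A i j).
Definition Mmul (k : nat) (A B : Mat) : Mat :=
  fun i j => Csum k (fun l => Cmul (A i l) (B l j)).
Definition Madj (A : Mat) : Mat := fun i j => Cconj (A j i).
Definition Mtrace (d : nat) (A : Mat) : C := Csum d (fun i => A i i).
Fixpoint Mpow (d : nat) (A : Mat) (k : nat) : Mat :=
  match k with O => Mid | S k' => Mmul d (Mpow d A k') A end.
Definition Mzero : Mat := fun _ _ => C0.
Fixpoint Msum (l : list Mat) : Mat :=
  match l with nil => Mzero | A :: l' => Madd A (Msum l') end.

(** Kronecker product A ⊗ B where B is a p x q matrix:
    (A ⊗ B)[i p' , j q'] with i = a*p + b, j = a'*q + b'. *)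
Definition kron (p q : nat) (A B : Mat) : Mat :=
  fun i j => Cmul (A (i / p)%nat (j / q)%nat) (B (i mod p)%nat (j mod q)%nat).

(** n-fold tensor power of a d x d matrix (0-fold power = 1x1 identity). *)
Fixpoint tpow (d : nat) (A : Mat) (n : nat) : Mat :=
  match n with O => Mid | S n' => kron d d (tpow d A n') A end.

Definition Mhermitian (d : nat) (A : Mat) : Prop :=
  forall i j, (i < d)%nat -> (j < d)%nat -> A i j = Cconj (A j i).

Definition Mpsd (d : nat) (A : Mat) : Prop :=
  Mhermitian d A /\
  forall v : nat -> C,
    0 <= re (Csum d (fun i => Csum d (fun j => Cmul (Cconj (v i)) (Cmul (A i j) (v j))))).

Definition density (d : nat) (rho : Mat) : Prop :=
  Mpsd d rho /\ Mtrace d rho = C1.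

(** * Trace norm ||A||_1 = Tr sqrt(A A^dagger):
    [trnorm d A x] means x = Tr S where S is the (unique) PSD square root
    of A A^dagger. *)
Definition trnorm (d : nat) (A : Mat) (x : R) : Prop :=
  exists S : Mat, Mpsd d S /\
    (forall i j, (i < d)%nat -> (j < d)%nat ->
       Mmul d S S i j = Mmul d A (Madj A) i j) /\
    re (Mtrace d S) = x.

Definition expm_partial (d : nat) (M : Mat) (N : nat) : Mat :=
  fun i j => Csum (S N) (fun k =>
    Cmul (mkC (/ INR (fact k)) 0) (Mpow d M k i j)).

Definition Mexp_is (d : nat) (M U : Mat) : Prop :=
  forall i j, (i < d)%nat -> (j < d)%nat ->
    Un_cv (fun N => re (expm_partial d M N i j)) (re (U i j)) /\
    Un_cv (fun N => im (expm_partial d M N i j)) (im (U i j)).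

(** * Quantum channels in Kraus form.
    [is_channel dout din Ks]: the K in Ks are dout x din matrices with
    sum_K K^dagger K = 1 (trace preserving; CP by construction). *)
Definition is_channel (dout din : nat) (Ks : list Mat) : Prop :=
  forall i j, (i < din)%nat -> (j < din)%nat ->
    Msum (map (fun K => Mmul dout (Madj K) K) Ks) i j = Mid i j.

(** Protocol on A ⊗ A_1 ⊗ ... ⊗ A_n -> A (a Kraus operator K is
    dA x (dA*N), N = dA^n, column index a*N + x), tensored with id_B,
    acting on the input ordered as (A ⊗ B) ⊗ (A_1 ⊗ ... ⊗ A_n):
    row index a*dB + b, column index (a'*dB + b')*N + x. *)
Definition lift_kraus (dB N : nat) (K : Mat) : Mat :=
  fun i j =>
    let a := (i / dB)%nat in let b := (i mod dB)%nat in
    let ab' := (j / N)%nat in let x := (j mod N)%nat in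
    let a' := (ab' / dB)%nat in let b' := (ab' mod dB)%nat in
    if Nat.eqb b b' then K a (a' * N + x)%nat else C0.

Definition apply_lifted (din dB N : nat) (Ks : list Mat) (inp : Mat) : Mat :=
  Msum (map (fun K => let L := lift_kraus dB N K in
                      Mmul din (Mmul din L inp) (Madj L)) Ks).

(* Main.v *)
(** Apply [n] times, with a fresh copy of [rho] each time, the partial swap
    [c - i s S] between A and the copy, with [s = t / n] and [c = sqrt (1 - s^2)],
    and discard the copy. One step sends [X] to
    [c^2 X + s^2 rho (x) Tr_A X - i c s [rho (x) 1, X]], which agrees with
    conjugation by [V = exp (- i s rho)] up to [13 s^2] in trace norm, and
    [V^n = exp (- i t rho)]. The errors compound to at most
    [(1 + 13 s^2)^n - 1 = O(t^2 / n)]; contractivity of the channel is not needed,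
    since its norm exceeds that of a unitary conjugation by at most [13 s^2].
    Trace norms are bounded by duality with the operator norm. *)

(* Two encodings shape the argument. The trace norm is a relation through a positive square root, in
   which sums are awkward to estimate. All estimates are therefore made on [trbound], which
   quantifies over test operators; it is converted into a trace norm only for the final difference,
   whose Hermiticity permits a spectral decomposition. Secondly, the lifted Kraus operators see [B]
   between [A] and the copies. Matrices on AB are cut into blocks indexed by [B], each of which the
   protocol treats as an operator on [A] alone.

   The 13 s^2 comes from writing V as 1 - i s rho plus a remainder of norm at most 2 s^2: the orders
   0 and 1 cancel, and every surviving term carries s^2. Taking s = t / n rather than sin (t / n)
   keeps the protocol algebraic and is itself a second-order change. Compounding is controlled only
   while 13 n s^2 <= 1/2, which is why large [delta] is treated apart. *)
Require Import Defs.
From Stdlib Require Import Reals Lra Lia ZArith Factorial.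
Open Scope R_scope.

(** * The scalar exponential series at an imaginary argument *)

Fixpoint Cpow (x : Defs.C) (k : nat) : Defs.C :=
  match k with O => Defs.C1 | S k' => Cmul (Cpow x k') x end.

Lemma Cpow_imaginary_even theta m :
  Cpow (mkC 0 (- theta)) (2 * m) = mkC ((-1) ^ m * Rsqr theta ^ m) 0.
Proof.
  induction m as [|m IH].
  - simpl. unfold Defs.C1. f_equal; ring.
  - replace (2 * S m)%nat with (S (S (2 * m)))%nat by lia.
    cbn [Cpow]. rewrite IH. unfold Cmul, Rsqr. cbn [re im pow]. f_equal; ring.
Qed.

Definition Cexp_partial (x : Defs.C) (N : nat) : Defs.C :=
  Csum (S N) (fun k => Cmul (mkC (/ INR (fact k)) 0) (Cpow x k)).

(** The terms 2j and 2j + 1 together give one term of the cosine and one of the sine series, which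
    are power series in theta^2. Hence the closed form only for sums that end at an odd index. *)
Lemma exp_imaginary_partial theta m :
  Cexp_partial (mkC 0 (- theta)) (2 * m + 1) =
  mkC (sum_f_R0 (fun i => cos_n i * Rsqr theta ^ i) m)
      (- (theta * sum_f_R0 (fun i => sin_n i * Rsqr theta ^ i) m)).
Proof.
  unfold Cexp_partial. assert (two : forall j, Cadd
     (Cmul (mkC (/ INR (fact (2 * j))) 0) (Cpow (mkC 0 (- theta)) (2 * j)))
     (Cmul (mkC (/ INR (fact (2 * j + 1))) 0) (Cpow (mkC 0 (- theta)) (2 * j + 1)))
     = mkC (cos_n j * Rsqr theta ^ j) (- (theta * (sin_n j * Rsqr theta ^ j)))).
  { intro j. replace (Cpow (mkC 0 (- theta)) (2 * j + 1))
      with (Cmul (Cpow (mkC 0 (- theta)) (2 * j)) (mkC 0 (- theta)))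
      by (rewrite Nat.add_1_r; reflexivity).
    rewrite Cpow_imaginary_even. unfold cos_n, sin_n, Cadd, Cmul, Rdiv.
    cbn [re im]. f_equal; ring. }
  induction m as [|m IH].
  - specialize (two 0%nat). cbn [Nat.mul Nat.add] in two.
    change (Csum (S (2 * 0 + 1)) ?f) with (Cadd (Cadd C0 (f 0%nat)) (f 1%nat)).
    cbn [sum_f_R0]. rewrite <- two. unfold Cadd. cbn [re im C0]. f_equal; ring.
  - replace (S (2 * S m + 1)) with (S (S (S (2 * m + 1)))) by lia.
    set (f := fun k => Cmul (mkC (/ INR (fact k)) 0) (Cpow (mkC 0 (- theta)) k)) in *.
    change (Csum (S (S (S (2 * m + 1)))) f)
      with (Cadd (Cadd (Csum (S (2 * m + 1)) f) (f (S (2 * m + 1)))) (f (S (S (2 * m + 1))))).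
    rewrite IH. specialize (two (S m)).
    replace (2 * S m + 1)%nat with (S (S (2 * m + 1))) in two by lia.
    replace (2 * S m)%nat with (S (2 * m + 1)) in two by lia.
    change (Cadd (f (S (2 * m + 1))) (f (S (S (2 * m + 1)))) =
      mkC (cos_n (S m) * Rsqr theta ^ S m) (- (theta * (sin_n (S m) * Rsqr theta ^ S m)))) in two.
    cbn [sum_f_R0]. revert two. generalize (f (S (2 * m + 1))) (f (S (S (2 * m + 1)))).
    intros u v two. pose proof (f_equal re two) as h1. pose proof (f_equal im two) as h2.
    unfold Cadd in *. cbn [re im] in *.
    f_equal.
    + rewrite Rplus_assoc. rewrite h1. reflexivity.
    + rewrite Rplus_assoc. rewrite h2. ring.
Qed.

(** The odd indices suffice: this only has to identify the limit of a series whose convergence is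
    part of [Mexp_is]. *)
Lemma exp_imaginary_cv theta :
  let u m := Cexp_partial (mkC 0 (- theta)) (2 * m + 1) in
  Un_cv (fun m => re (u m)) (cos theta) /\ Un_cv (fun m => im (u m)) (- sin theta).
Proof.
  intro u. unfold u. split.
  - apply Un_cv_ext with (un := fun m => sum_f_R0 (fun i => cos_n i * Rsqr theta ^ i) m).
    + intro m. rewrite exp_imaginary_partial. reflexivity.
    + unfold cos. destruct (exist_cos (Rsqr theta)) as [a h]. exact h.
  - apply Un_cv_ext with (un := fun m => (- theta) * sum_f_R0 (fun i => sin_n i * Rsqr theta ^ i) m).
    + intro m. rewrite exp_imaginary_partial. cbn [im]. ring.
    + unfold sin. destruct (exist_sin (Rsqr theta)) as [a h].
      replace (- (theta * a)) with ((- theta) * a) by ring.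
      apply CV_mult; [|exact h].
      intros eps Heps. exists 0%nat. intros. unfold R_dist. rewrite Rminus_diag, Rabs_R0. exact Heps.
Qed.

(** * Second-order estimates for real numbers *)

Lemma cos_quadratic_bound theta : Rabs (cos theta - 1) <= theta ^ 2.
Proof.
  (* Half-angle identity; the claim reduces to sin^2 x <= x^2 at x = theta / 2. *)
  replace (cos theta - 1) with (- (2 * (sin (theta / 2)) ^ 2)).
  2:{ replace theta with (2 * (theta / 2)) at 2 by field. rewrite cos_2a_sin. ring. }
  rewrite Rabs_Ropp, Rabs_right.
  2:{ nra. }
  assert (h : forall x, 0 <= x -> (sin x) ^ 2 <= x ^ 2).
  { intros x [hx | <-]; [|rewrite sin_0; lra].
    pose proof (sin_lt_x x hx). pose proof (SIN_bound x).
    destruct (Rle_dec 0 (sin x)); [nra|].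
    destruct (Rle_dec 1 x); [nra|].
    exfalso. assert (0 <= sin x); [|lra]. apply sin_ge_0; pose proof PI2_1; lra. }
  assert (h2 : (sin (theta / 2)) ^ 2 <= (theta / 2) ^ 2).
  { destruct (Rle_dec 0 theta).
    - apply h. lra.
    - pose proof (h (- (theta / 2)) ltac:(lra)) as h3. rewrite sin_neg in h3. nra. }
  nra.
Qed.

(** On [0, 1], x - x^3 / 6 <= sin x <= x, and x^3 <= x^2; negative arguments follow by oddness. *)
Lemma sin_linear_bound theta : Rabs theta <= 1 -> Rabs (sin theta - theta) <= theta ^ 2.
Proof.
  assert (h : forall x, 0 <= x <= 1 -> Rabs (sin x - x) <= x ^ 2).
  { intros x [[hx | <-] hx1].
    - pose proof (sin_lt_x x hx).
      destruct (sin_bound x 0) as [h1 _]; [lra | pose proof PI2_1; lra |].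
      unfold sin_approx, sin_term in h1. simpl in h1. 
      rewrite Rabs_left by lra.
      assert (x * x * x <= x * x) by nra. lra.
    - rewrite sin_0, Rminus_0_r, Rabs_R0. lra. }
  intro ht. destruct (Rle_dec 0 theta).
  - apply h. rewrite Rabs_right in ht; lra.
  - rewrite Rabs_left in ht by lra. pose proof (h (- theta) ltac:(lra)) as h3.
    rewrite sin_neg in h3. rewrite <- Rabs_Ropp.
    replace (- (sin theta - theta)) with (- sin theta - - theta) by ring. nra.
Qed.

(** A Bernoulli-type bound (1 + a)^k <= 1 / (1 - k a), stated without division. With b = n a <= 1/2
    it gives (1 + a)^n - 1 <= b / (1 - b) <= 2 b. *)
Lemma compound_bound a n : 0 <= a -> INR n * a <= 1 / 2 -> (1 + a) ^ n - 1 <= 2 * (INR n * a).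
Proof.
  intros a0 hn.
  assert (h : forall k, (k <= n)%nat -> (1 + a) ^ k * (1 - INR k * a) <= 1).
  { induction k as [|k IH]; intro hk.
    - simpl. lra.
    - specialize (IH ltac:(lia)). rewrite S_INR. cbn [pow].
      assert (0 < (1 + a) ^ k) by (apply pow_lt; lra).
      pose proof (pos_INR k).
      (* Since (1 + a) (1 - (k + 1) a) = (1 - k a) - (k + 1) a^2, this is the quantity dropped in
         the induction step. *)
      assert (0 <= (1 + a) ^ k * (INR k + 1) * (a * a)).
      { apply Rmult_le_pos; [apply Rmult_le_pos|]; nra. }
      nra. }
  specialize (h n (le_n n)).
  set (q := (1 + a) ^ n) in *. set (b := INR n * a) in *.
  assert (0 <= b) by (unfold b; apply Rmult_le_pos; [apply pos_INR | exact a0]).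
  assert (0 < q) by (apply pow_lt; lra).
  nra.
Qed.

(** Since 0 <= c <= 1, 1 - c <= 1 - c^2 = s^2. It lets the commutator coefficient [c * s] of the
    step pass for [s] at second order. *)
Lemma sqrt_sine_bound c s : 0 <= c -> s ^ 2 <= 1 -> c ^ 2 = 1 - s ^ 2 ->
  Rabs (c * s - s) <= s ^ 2.
Proof.
  intros c0 s1 cs. replace (c * s - s) with (- ((1 - c) * s)) by ring.
  assert (c1 : c <= 1) by nra. assert (h : 1 - c <= s ^ 2) by nra.
  rewrite Rabs_Ropp, Rabs_mult, (Rabs_right (1 - c)) by lra.
  assert (Rabs s <= 1).
  { apply Rsqr_incr_0_var; [|lra]. rewrite <- Rsqr_abs. unfold Rsqr. lra. }
  pose proof (Rabs_pos s). nra.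
Qed.
Module LMR.

From mathcomp Require Import all_boot all_order all_algebra.
From mathcomp Require spectral sesquilinear.
From mathcomp Require Import mxtens ring complex Rstruct.
Set Implicit Arguments. Unset Strict Implicit. Unset Printing Implicit Defensive.
Import Order.TTheory GRing.Theory Num.Theory.
Local Open Scope ring_scope.

(** * Adjoints, tensor products and the spectral theorem *)

Section Adjoint.
Variable C : numClosedFieldType.

Definition adjmx m n (A : 'M[C]_(m, n)) : 'M[C]_(n, m) := map_mx Num.conj A^T.

Lemma adjmxE m n (A : 'M[C]_(m, n)) i j : adjmx A i j = (A j i)^*.
Proof. by rewrite !mxE. Qed.

Lemma adjmxK m n (A : 'M[C]_(m, n)) : adjmx (adjmx A) = A.
Proof. by apply/matrixP => i j; rewrite !adjmxE conjCK. Qed.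

Lemma adjmxM m n p (A : 'M[C]_(m, n)) (B : 'M[C]_(n, p)) :
  adjmx (A *m B) = adjmx B *m adjmx A.
Proof. by rewrite /adjmx trmx_mul map_mxM. Qed.

Lemma adjmxD m n (A B : 'M[C]_(m, n)) : adjmx (A + B) = adjmx A + adjmx B.
Proof. by apply/matrixP => i j; rewrite !mxE rmorphD. Qed.

Lemma adjmxB m n (A B : 'M[C]_(m, n)) : adjmx (A - B) = adjmx A - adjmx B.
Proof. by apply/matrixP => i j; rewrite !mxE rmorphB. Qed.

Lemma adjmxZ m n a (A : 'M[C]_(m, n)) : adjmx (a *: A) = a^* *: adjmx A.
Proof. by apply/matrixP => i j; rewrite !mxE rmorphM. Qed.

Lemma adjmx1 n : adjmx (1%:M : 'M[C]_n) = 1%:M.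
Proof. by apply/matrixP => i j; rewrite !mxE eq_sym; case: eqP; rewrite /= ?rmorph1 ?rmorph0. Qed.

Lemma adjmx_diag n (d : 'rV[C]_n) : adjmx (diag_mx d) = diag_mx (map_mx Num.conj d).
Proof.
apply/matrixP => i j; rewrite !mxE eq_sym; case: eqP => [->|_] //=.
by rewrite !mulr0n rmorph0.
Qed.

Lemma adjmx_tens m n p q (A : 'M[C]_(m, n)) (B : 'M[C]_(p, q)) :
  adjmx (A *t B) = adjmx A *t adjmx B.
Proof. by apply/matrixP => i j; rewrite !mxE rmorphM. Qed.

Lemma tensmx11 m n : (1%:M : 'M[C]_m) *t (1%:M : 'M[C]_n) = 1%:M.
Proof.
apply/matrixP => i j.
case: (mxtens_indexP i) => i0 i1; case: (mxtens_indexP j) => j0 j1.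
by rewrite tensmxE !mxE (can_eq (@mxtens_indexK m n)) xpair_eqE -mulnb natrM.
Qed.

Lemma tensmx_suml (I : Type) (l : seq I) m n p q (F : I -> 'M[C]_(m, n)) (B : 'M[C]_(p, q)) :
  (\sum_(x <- l) F x) *t B = \sum_(x <- l) F x *t B.
Proof.
apply/matrixP => i j; rewrite summxE mxE summxE mulr_suml.
by apply: eq_bigr => x _; rewrite mxE.
Qed.

(** Fixes the convention A = P^dagger diag(d) P, under which functions of a Hermitian matrix are
    later computed on [d]. *)
Lemma hermitian_diagonalization n (A : 'M[C]_n) : adjmx A = A ->
  exists (P : 'M[C]_n) (d : 'rV[C]_n),
    [/\ P *m adjmx P = 1%:M, adjmx P *m P = 1%:M,
        A = adjmx P *m diag_mx d *m P & forall i, d 0 i \is Num.real].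
Proof.
move=> hA.
have hermA : A \is sesquilinear.hermitianmx _ false Num.conj.
  by apply/sesquilinear.is_hermitianmxP; rewrite expr0 scale1r.
have uP := spectral.spectral_unitarymx A.
have PP : spectral.spectralmx A *m adjmx (spectral.spectralmx A) = 1%:M.
  exact/spectral.unitarymxP.
exists (spectral.spectralmx A), (spectral.spectral_diag A); split => //.
- exact: mulmx1C.
- have /spectral.orthomx_spectralP {1}-> := spectral.hermitian_normalmx hermA.
  by rewrite spectral.invmx_unitary.
- move=> i; have /mxOverP := spectral.hermitian_spectral_diag_real hermA.
  exact.
Qed.

End Adjoint.

(** * Operator-norm bounds and the dual trace-norm bound *)

Section OperatorBound.
Variable C : numClosedFieldType.

Definition normsq n (v : 'cV[C]_n) : C := \sum_i `|v i 0| ^+ 2.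

(** An upper bound on the operator norm, squared so that neither a supremum nor a root appears. In
    the partial order of the complex field, [0 <= k] also says that [k] is real. *)
Definition opbound n (k : C) (W : 'M[C]_n) :=
  0 <= k /\ forall v : 'cV_n, normsq (W *m v) <= k ^+ 2 * normsq v.

Lemma normsqE n (v : 'cV[C]_n) : normsq v = (adjmx v *m v) 0 0.
Proof. by rewrite !mxE; apply: eq_bigr => i _; rewrite adjmxE normCK mulrC. Qed.

Lemma opboundM n k l (A B : 'M[C]_n) : opbound k A -> opbound l B -> opbound (k * l) (A *m B).
Proof.
move=> [k0 hA] [l0 hB]; split; first exact: mulr_ge0.
move=> v; rewrite -mulmxA exprMn -mulrA; apply: le_trans (hA _) _.
by rewrite ler_wpM2l // exprn_ge0.
Qed.

Lemma opbound_isometry n (P : 'M[C]_n) : adjmx P *m P = 1%:M -> opbound 1 P.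
Proof.
move=> PP; split=> // v.
by rewrite !normsqE expr1n mul1r adjmxM -mulmxA (mulmxA _ P) PP mul1mx.
Qed.

Lemma opbound_diag n k (d : 'rV[C]_n) : 0 <= k -> (forall i, `|d 0 i| <= k) ->
  opbound k (diag_mx d).
Proof.
move=> k0 hd; split=> // v; rewrite /normsq mulr_sumr; apply: ler_sum => i _.
rewrite mul_diag_mx mxE normrM exprMn ler_wpM2r ?exprn_ge0 //.
by rewrite lerXn2r // ?nnegrE.
Qed.

Lemma opbound_conj_diag n k (P : 'M[C]_n) (d : 'rV[C]_n) :
  P *m adjmx P = 1%:M -> 0 <= k -> (forall i, `|d 0 i| <= k) ->
  opbound k (adjmx P *m diag_mx d *m P).
Proof.
move=> PP k0 hd; rewrite -[k]mulr1 -[k]mul1r.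
apply: opboundM; first apply: opboundM.
- by apply: opbound_isometry; rewrite adjmxK.
- exact: opbound_diag.
- by apply: opbound_isometry; exact: mulmx1C.
Qed.

Lemma big_mxtens (R : nmodType) m n (F : 'I_(m * n) -> R) :
  \sum_i F i = \sum_i \sum_j F (mxtens_index (i, j)).
Proof.
rewrite pair_big /= (reindex (@mxtens_index m n)) /=; last first.
  by exists (@mxtens_unindex m n) => i _; rewrite ?mxtens_indexK ?mxtens_unindexK.
by apply: eq_bigr => -[].
Qed.

(** The tensored operator acts separately on each slice of [v] with fixed second index, and the
    squared norm is the sum over the slices. *)
Lemma opbound_tensmx1 d b k (A : 'M[C]_d) : opbound k A -> opbound k (A *t (1%:M : 'M_b)).
Proof.
move=> [k0 hA]; split=> // v.
rewrite /normsq !big_mxtens exchange_big [X in _ <= _ * X]exchange_big /= mulr_sumr.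
apply: ler_sum => j _.
pose w : 'cV[C]_d := \col_i v (mxtens_index (i, j)) 0.
have := hA w; rewrite /normsq; congr (_ <= _ * _); apply: eq_bigr => i _; last by rewrite mxE.
congr (`| _ | ^+ 2); rewrite !mxE big_mxtens; apply: eq_bigr => i' _.
rewrite (bigD1 j) //= big1 ?addr0 => [|j' ne]; rewrite tensmxE !mxE ?eqxx ?mulr1 //.
by rewrite eq_sym (negPf ne) mulr0 mul0r.
Qed.

(** The compression <j| W |j> to the second factor: pairing [W] with |j><j| (x) Y under the trace
    amounts to pairing this block with Y. *)
Definition diagblock d b (W : 'M[C]_(d * b)) (j : 'I_d) : 'M[C]_b :=
  \matrix_(x, y) W (mxtens_index (j, x)) (mxtens_index (j, y)).

(** For each slice of [v]: put it in slot [j], apply [W], keep only slot [j]. The embedding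
    preserves the norm and the restriction cannot increase it. *)
Lemma opbound_diagblock d b k (W : 'M[C]_(d * b)) j :
  opbound k W -> opbound k ((1%:M : 'M_d) *t diagblock W j).
Proof.
move=> [k0 hW]; split=> // v.
rewrite /normsq !big_mxtens mulr_sumr; apply: ler_sum => i _.
pose w : 'cV[C]_(d * b) := \col_l
  (v (mxtens_index (i, (mxtens_unindex l).2)) 0 *+ ((mxtens_unindex l).1 == j)).
have := hW w; rewrite /normsq [X in _ <= _ * X]big_mxtens (bigD1 j) //= [X in _ + X]big1 ?addr0; last first.
  by move=> l ne; apply: big1 => x _; rewrite mxE mxtens_indexK /= (negPf ne) mulr0n normr0 expr0n.
have -> : \sum_x `|w (mxtens_index (j, x)) 0| ^+ 2 = \sum_x `|v (mxtens_index (i, x)) 0| ^+ 2.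
  by apply: eq_bigr => x _; rewrite mxE mxtens_indexK eqxx.
apply: le_trans; rewrite big_mxtens (bigD1 j) //= -[leLHS]addr0; apply: lerD; last first.
  by apply: sumr_ge0 => l _; apply: sumr_ge0 => x _; rewrite exprn_ge0.
rewrite le_eqVlt; apply/orP; left; apply/eqP; apply: eq_bigr => x _; congr (`|_| ^+ 2).
rewrite !mxE !big_mxtens (bigD1 i) //= [X in _ + X]big1 ?addr0; last first.
  by move=> l ne; apply: big1 => y _; rewrite tensmxE !mxE eq_sym (negPf ne) mul0r mul0r.
rewrite (bigD1 j) //= [X in _ = _ + X]big1 ?addr0; last first.
  by move=> l ne; apply: big1 => y _; rewrite !mxE mxtens_indexK /= (negPf ne) mulr0n mulr0.
by apply: eq_bigr => y _; rewrite tensmxE !mxE mxtens_indexK !eqxx mul1r mulr1n.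
Qed.

Lemma opbound_entry n k (W : 'M[C]_n) j : opbound k W -> `|W j j| <= k.
Proof.
move=> [k0 /(_ (delta_mx j 0))]; rewrite -colE /normsq => h.
rewrite -(@ler_pXn2r _ 2) ?nnegrE //; apply: le_trans (le_trans h _).
  by rewrite (bigD1 j) //= mxE lerDl; apply: sumr_ge0 => i _; rewrite exprn_ge0.
rewrite (bigD1 j) //= big1 => [|i ne]; rewrite !mxE ?eqxx ?normr1 ?expr1n ?addr0 ?mulr1 //.
by rewrite (negPf ne) normr0 expr0n.
Qed.

(* Trace-norm bound by duality with the operator norm. *)
Definition trbound n (X : 'M[C]_n) (e : C) :=
  forall k W, opbound k W -> `|\tr (W *m X)| <= k * e.

Lemma trboundD n (X Y : 'M[C]_n) e f : trbound X e -> trbound Y f -> trbound (X + Y) (e + f).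
Proof.
move=> hX hY k W hW; rewrite mulmxDr mxtraceD mulrDr.
by apply: le_trans (ler_normD _ _) (lerD (hX _ _ hW) (hY _ _ hW)).
Qed.

Lemma trboundZ n (X : 'M[C]_n) a e : trbound X e -> trbound (a *: X) (`|a| * e).
Proof.
move=> hX k W hW; rewrite -scalemxAr mxtraceZ normrM mulrCA.
by rewrite ler_wpM2l //; apply: hX.
Qed.

Lemma trboundN n (X : 'M[C]_n) e : trbound X e -> trbound (- X) e.
Proof. by move=> /(trboundZ (-1)); rewrite scaleN1r normrN1 mul1r. Qed.

Lemma trboundB n (X Y : 'M[C]_n) e f : trbound X e -> trbound Y f -> trbound (X - Y) (e + f).
Proof. by move=> hX /trboundN; apply: trboundD. Qed.

Lemma trbound_le n (X : 'M[C]_n) e f : e <= f -> trbound X e -> trbound X f.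
Proof. by move=> ef hX k W hW; apply: le_trans (hX _ _ hW) _; rewrite ler_wpM2l //; case: hW. Qed.

Lemma trbound_mull n (Q X : 'M[C]_n) q e : opbound q Q -> trbound X e -> trbound (Q *m X) (q * e).
Proof. by move=> hQ hX k W hW; rewrite mulmxA mulrA; apply/hX/opboundM. Qed.

Lemma trbound_mulr n (Q X : 'M[C]_n) q e : opbound q Q -> trbound X e -> trbound (X *m Q) (q * e).
Proof.
move=> hQ hX k W hW; rewrite mulmxA mxtrace_mulC mulmxA mulrA (mulrC k).
by apply/hX/opboundM.
Qed.

(** In the eigenbasis, the trace against [W] is an average with weights [p] of diagonal entries of P
    W P^dagger, each at most [k] in modulus. *)
Lemma trbound_conj_diag n (P : 'M[C]_n) (p : 'rV[C]_n) :
  P *m adjmx P = 1%:M -> (forall i, 0 <= p 0 i) -> \sum_i p 0 i = 1 ->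
  trbound (adjmx P *m diag_mx p *m P) 1.
Proof.
move=> PP p0 p1 k W hW.
have hW' : opbound k (P *m W *m adjmx P).
  rewrite -[k]mulr1 -[k]mul1r; apply: opboundM; first apply: opboundM => //.
    by apply: opbound_isometry; exact: mulmx1C.
  by apply: opbound_isometry; rewrite adjmxK.
have -> : \tr (W *m (adjmx P *m diag_mx p *m P)) = \tr (P *m W *m adjmx P *m diag_mx p).
  by rewrite [RHS]mxtrace_mulC !mulmxA mxtrace_mulC !mulmxA [in RHS]mxtrace_mulC !mulmxA.
rewrite /mxtrace -p1 mulr_sumr; apply: le_trans (ler_norm_sum _ _ _) _.
apply: ler_sum => i _; rewrite mul_mx_diag mxE normrM (ger0_norm (p0 i)).
by rewrite ler_wpM2r //; apply: opbound_entry.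
Qed.

End OperatorBound.

(** * One partial-swap step and its error *)

Section PartialSwap.
Variable C : numClosedFieldType.

Definition ptrace d b (X : 'M[C]_(d * b)) : 'M[C]_b :=
  \matrix_(x, y) \sum_i X (mxtens_index (i, x)) (mxtens_index (i, y)).

(* The channel [X |-> Tr_A1 (e^{-i theta S} (X (x) rho) e^{i theta S})] on the
   system AB, with [S] the swap of A and A1, [c = cos theta], [s = sin theta]. *)
Definition swapstep d b (c s : C) (rho : 'M[C]_d) (X : 'M[C]_(d * b)) : 'M[C]_(d * b) :=
  c ^+ 2 *: X + s ^+ 2 *: (rho *t ptrace X)
  - ('i * (c * s)) *: ((rho *t 1%:M) *m X - X *m (rho *t 1%:M)).

(** Computes the dual of X -> p (x) Tr_A X: a diagonal [p] is a combination of the |j><j|, so [W]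
    turns into the same combination of the 1 (x) <j| W |j>. *)
Lemma mxtrace_tens_diag d b (W X : 'M[C]_(d * b)) (p : 'rV[C]_d) :
  \tr (W *m (diag_mx p *t ptrace X)) =
  \sum_j p 0 j * \tr ((1%:M *t diagblock W j) *m X).
Proof.
rewrite /mxtrace big_mxtens; apply: eq_bigr => j _.
transitivity (p 0 j * \sum_x \sum_y W (mxtens_index (j, x)) (mxtens_index (j, y)) * ptrace X y x).
  rewrite mulr_sumr; apply: eq_bigr => x _; rewrite mxE big_mxtens (bigD1 j) //=.
  rewrite [X in _ + X]big1 ?addr0 => [|l ne].
    by rewrite mulr_sumr; apply: eq_bigr => y _; rewrite tensmxE !mxE eqxx mulr1n mulrCA.
  by apply: big1 => y _; rewrite tensmxE !mxE (negPf ne) mulr0n mul0r mulr0.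
congr (_ * _); rewrite [RHS]big_mxtens [RHS]exchange_big; apply: eq_bigr => x _.
rewrite (eq_bigr (fun y => \sum_i W (mxtens_index (j, x)) (mxtens_index (j, y)) *
    X (mxtens_index (i, y)) (mxtens_index (i, x)))); last first.
  by move=> y _; rewrite mxE mulr_sumr.
rewrite exchange_big; apply: eq_bigr => i _; rewrite mxE big_mxtens (bigD1 i) //=.
rewrite [X in _ + X]big1 ?addr0 => [|l ne].
  by apply: eq_bigr => y _; rewrite tensmxE !mxE eqxx mul1r.
by apply: big1 => y _; rewrite tensmxE !mxE eq_sym (negPf ne) !mul0r.
Qed.

(** Replacing the [A] part by a state does not increase the trace norm, because the dual map is an
    average of compressions. The rotation [Q] that makes the state diagonal is absorbed into the
    test operator. *)
Lemma trbound_tens_ptrace d b (P : 'M[C]_d) (p : 'rV[C]_d) (X : 'M[C]_(d * b)) e :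
  P *m adjmx P = 1%:M -> (forall i, 0 <= p 0 i) -> \sum_i p 0 i = 1 ->
  trbound X e -> trbound ((adjmx P *m diag_mx p *m P) *t ptrace X) e.
Proof.
move=> PP p0 p1 hX k W hW.
pose Q := P *t (1%:M : 'M_b).
have QQ : Q *m adjmx Q = 1%:M.
  by rewrite adjmx_tens adjmx1 tensmx_mul PP mulmx1 tensmx11.
have hW' : opbound k (Q *m W *m adjmx Q).
  rewrite -[k]mulr1 -[k]mul1r; apply: opboundM; first apply: opboundM => //.
    by apply: opbound_isometry; exact: mulmx1C.
  by apply: opbound_isometry; rewrite adjmxK.
have -> : (adjmx P *m diag_mx p *m P) *t ptrace X = adjmx Q *m (diag_mx p *t ptrace X) *m Q.
  by rewrite adjmx_tens adjmx1 !tensmx_mul mul1mx mulmx1.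
have -> : \tr (W *m (adjmx Q *m (diag_mx p *t ptrace X) *m Q)) =
    \tr (Q *m W *m adjmx Q *m (diag_mx p *t ptrace X)).
  by rewrite -[in RHS]mulmxA -[in RHS]mulmxA [RHS]mxtrace_mulC !mulmxA.
rewrite mxtrace_tens_diag.
have -> : k * e = \sum_j p 0 j * (k * e) by rewrite -mulr_suml p1 mul1r.
apply: le_trans (ler_norm_sum _ _ _) _.
apply: ler_sum => j _; rewrite normrM (ger0_norm (p0 j)) ler_wpM2l //.
exact: hX (opbound_diagblock j hW').
Qed.

(** Keeps the final difference Hermitian, as the conversion of [trbound] into a trace norm
    requires. *)
Lemma adjmx_swapstep d b (c s : C) (rho : 'M[C]_d) (X : 'M[C]_(d * b)) :
  c \is Num.real -> s \is Num.real -> adjmx rho = rho -> adjmx X = X ->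
  adjmx (swapstep c s rho X) = swapstep c s rho X.
Proof.
move=> /CrealP cR /CrealP sR hr hX.
have hp : adjmx (ptrace X) = ptrace X.
  apply/matrixP => i j; rewrite adjmxE !mxE rmorph_sum; apply: eq_bigr => l _.
  by rewrite -[in RHS]hX adjmxE.
rewrite /swapstep !(adjmxB, adjmxD, adjmxZ, adjmx_tens, adjmxM) adjmx1 hp hr hX.
rewrite !rmorphXn !rmorphM /= cR sR conjCi mulNr scaleNr.
by rewrite -scalerN opprB.
Qed.

Section OneStep.
Variables (d b : nat) (P : 'M[C]_d) (p : 'rV[C]_d) (V : 'M[C]_d) (c s : C).
Let rho := adjmx P *m diag_mx p *m P.
Let R := rho *t (1%:M : 'M[C]_b).
Let VB := V *t (1%:M : 'M[C]_b).
(** The remainder of exp(- i s rho) beyond first order. In this section the exponential enters only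
    through the bounds on [V], [Q] and their adjoints. *)
Let Q := V - 1%:M + ('i * s) *: rho.
Hypothesis PP : P *m adjmx P = 1%:M.
Hypothesis p0 : forall i, 0 <= p 0 i.
Hypothesis p1 : \sum_i p 0 i = 1.
Hypothesis sR : s \is Num.real.
Hypothesis s1 : s ^+ 2 <= 1.
Hypothesis cs1 : c ^+ 2 = 1 - s ^+ 2.
Hypothesis css : `|c * s - s| <= s ^+ 2.
Hypotheses (hV : opbound 1 V) (hV' : opbound 1 (adjmx V)).
Hypotheses (hQ : opbound (2 * s ^+ 2) Q) (hQ' : opbound (2 * s ^+ 2) (adjmx Q)).

Let hrho : adjmx rho = rho.
Proof.
rewrite /rho !adjmxM adjmxK adjmx_diag -mulmxA; congr (_ *m (diag_mx _ *m _)).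
by apply/rowP => i; rewrite mxE; apply/CrealP/ger0_real.
Qed.

(** Writing V = Q + (1 - i s rho) makes the orders 0 and 1 cancel: what is left carries s^2, [Q] or
    [c * s - s]. *)
Lemma swapstep_error_expand (X : 'M[C]_(d * b)) (QB := Q *t (1%:M : 'M[C]_b)) :
  swapstep c s rho X - VB *m X *m adjmx VB =
  (s ^+ 2 *: (rho *t ptrace X) - s ^+ 2 *: X
   - ('i * (c * s - s)) *: (R *m X - X *m R))
  - (QB *m X *m adjmx VB + (VB - QB) *m X *m adjmx QB + s ^+ 2 *: (R *m X *m R)).
Proof.
have eQ : VB - QB = 1%:M - ('i * s) *: R.
  have -> : VB - QB = (V - Q) *t 1%:M.
    by apply/matrixP => i j; rewrite !mxE mulrBl.
  have -> : V - Q = 1%:M - ('i * s) *: rho.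
    by apply/matrixP => i j; rewrite !mxE; ring.
  apply/matrixP => i j; rewrite /R; case: (mxtens_indexP i) => i0 i1; case: (mxtens_indexP j) => j0 j1.
  rewrite tensmxE !mxE !mxtens_indexK /= (can_eq (@mxtens_indexK d b)) xpair_eqE.
  by rewrite -mulnb natrM mulrBl mulrA.
have eQ' : adjmx VB - adjmx QB = 1%:M + ('i * s) *: R.
  rewrite -adjmxB eQ adjmxB adjmx1 adjmxZ adjmx_tens adjmx1 hrho.
  by rewrite rmorphM /= conjCi (CrealP sR) mulNr scaleNr opprK.
(* V is exchanged for V - Q on one side at a time; only the last product is then expanded. *)
have -> : VB *m X *m adjmx VB = QB *m X *m adjmx VB + (VB - QB) *m X *m adjmx QB
    + (VB - QB) *m X *m (adjmx VB - adjmx QB).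
  rewrite -addrA -mulmxDr [adjmx QB + _]addrC subrK !mulmxBl.
  by rewrite [RHS]addrC subrK.
have -> : (VB - QB) *m X *m (adjmx VB - adjmx QB) =
   X - ('i * s) *: (R *m X - X *m R) + s ^+ 2 *: (R *m X *m R).
  rewrite eQ eQ' mulmxBl mul1mx mulmxDr mulmx1 mulmxBl -!scalemxAr -!scalemxAl.
  have -> : ('i * s) *: (('i * s) *: (R *m X *m R)) = - (s ^+ 2 *: (R *m X *m R)).
    rewrite scalerA mulrACA -!expr2 sqrCi mulN1r scaleNr //.
  apply/matrixP => i j; rewrite !mxE; ring.
rewrite /swapstep -/R cs1.
apply/matrixP => i j; rewrite !mxE; ring.
Qed.

(** In units of s^2 e, 13 is 1 + 1 + 2 for the replaced state, the s^2 X term and the commutator,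
    plus 2 + 6 for the two terms with [Q], plus 1 for R X R. The 6 bounds 2 (1 + 2 s^2), where V - Q
    is estimated by the triangle inequality. *)
Lemma swapstep_error (X : 'M[C]_(d * b)) e : 0 <= e -> trbound X e ->
  trbound (swapstep c s rho X - VB *m X *m adjmx VB) (13 * s ^+ 2 * e).
Proof.
move=> e0 hX; rewrite swapstep_error_expand.
have s20 : 0 <= s ^+ 2 by rewrite -realEsqr.
have hR : opbound 1 R.
  apply/opbound_tensmx1/opbound_conj_diag => // i.
  by rewrite (ger0_norm (p0 i)) -p1 (bigD1 i) //= lerDl sumr_ge0.
have hVB : opbound 1 VB by apply: opbound_tensmx1.
have hVB' : opbound 1 (adjmx VB) by rewrite adjmx_tens adjmx1; apply: opbound_tensmx1.
have hQB : opbound (2 * s ^+ 2) (Q *t (1%:M : 'M[C]_b)) by apply: opbound_tensmx1.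
have hQB' : opbound (2 * s ^+ 2) (adjmx (Q *t (1%:M : 'M[C]_b))).
  by rewrite adjmx_tens adjmx1; apply: opbound_tensmx1.
set QB := Q *t _ in hQB hQB' *.
apply: trbound_le; last first.
  apply: trboundB; first apply: trboundB; first apply: trboundB.
  - exact/trboundZ/trbound_tens_ptrace/hX.
  - exact/trboundZ/hX.
  - by apply: trboundZ; apply: trboundB; [apply: trbound_mull hR hX | apply: trbound_mulr hR hX].
  - apply: trboundD; first apply: trboundD.
    + exact: (trbound_mulr hVB' (trbound_mull hQB hX)).
    + rewrite mulmxBl; apply: (trbound_mulr hQB').
      exact: (trboundB (trbound_mull hVB hX) (trbound_mull hQB hX)).
    + exact: (trboundZ _ (trbound_mulr hR (trbound_mull hR hX))).
rewrite !mul1r !(ger0_norm s20) [`|'i * _|]normrM normCi mul1r.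
have := css; have := s1; move: s20; set a := s ^+ 2 => s20 a1 cssa.
have h1 : `|c * s - s| * (e + e) <= a * (e + e) by rewrite ler_wpM2r // addr_ge0.
have h2 : a * (a * e) <= a * e by rewrite ler_wpM2l // ler_piMl.
have -> : 13 * a * e = a * e + a * e + a * (e + e) + (2 * a * e + (2 * a * e + 4 * (a * e)) + a * e).
  by ring.
rewrite !lerD // mulrDr lerD //.
have -> : 2 * a * (2 * a * e) = 4 * (a * (a * e)) by ring.
by rewrite ler_wpM2l.
Qed.

(** Hybrid argument: the new difference is the one-step error at Y plus the conjugate of the old
    difference Y - Z. With a = 13 s^2 and q = (1 + a)^n, Y = (Y - Z) + Z is bounded by q, and a q +
    (q - 1) = (1 + a) q - 1. *)
Lemma iter_swapstep_error (X : 'M[C]_(d * b)) n : trbound X 1 ->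
  trbound (iter n (swapstep c s rho) X
           - iter n (fun Y => VB *m Y *m adjmx VB) X) ((1 + 13 * s ^+ 2) ^+ n - 1).
Proof.
move=> hX.
have s20 : 0 <= s ^+ 2 by rewrite -realEsqr.
have hVB : opbound 1 VB by apply: opbound_tensmx1.
have hVB' : opbound 1 (adjmx VB) by rewrite adjmx_tens adjmx1; apply: opbound_tensmx1.
have hconj Y e : trbound Y e -> trbound (VB *m Y *m adjmx VB) e.
  by move=> hY; have := trbound_mulr hVB' (trbound_mull hVB hY); rewrite !mul1r.
have hiter k : trbound (iter k (fun Y => VB *m Y *m adjmx VB) X) 1.
  by elim: k => //= k IH; apply: hconj.
elim: n => [|n IH] /=; first by move=> k W hW; rewrite subrr mulmx0 mxtrace0 normr0 expr0 subrr mulr0.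
set Y := iter n (swapstep c s rho) X in IH *; set Z := iter n _ X in IH *.
have hY : trbound Y ((1 + 13 * s ^+ 2) ^+ n).
  by have := trboundD IH (hiter n); rewrite !subrK.
have q0 : 0 <= (1 + 13 * s ^+ 2) ^+ n by rewrite exprn_ge0 // addr_ge0 // mulr_ge0.
have := trboundD (swapstep_error q0 hY) (hconj _ _ IH).
rewrite mulmxBr mulmxBl [X in trbound X]addrA subrK.
move: (13 * s ^+ 2) => a.
by rewrite exprS mulrDl mul1r addrA [a * _ + _]addrC.
Qed.

End OneStep.
End PartialSwap.

(** * Translation of indexed functions into finite complex matrices *)

Section Translation.
Local Notation CC := (complex R).

Definition toC (x : Defs.C) : CC := Complex (re x) (im x).

Lemma toC_inj : injective toC.
Proof. by move=> [a b] [a' b'] [-> ->]. Qed.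

Lemma toC0 : toC C0 = 0. Proof. by []. Qed.
Lemma toC1 : toC Defs.C1 = 1. Proof. by []. Qed.
Lemma toCD x y : toC (Cadd x y) = toC x + toC y. Proof. by []. Qed.
Lemma toCN x : toC (Copp x) = - toC x. Proof. by []. Qed.
Lemma toCM x y : toC (Cmul x y) = toC x * toC y. Proof. by []. Qed.
Lemma toC_conj x : toC (Cconj x) = (toC x)^*. Proof. by []. Qed.

Lemma toC_sum n f : toC (Csum n f) = \sum_(i < n) toC (f i).
Proof. by elim: n => [|n IH]; rewrite ?big_ord0 // big_ord_recr /= toCD IH. Qed.

(** The two divisions agree at [p = 0] too, with quotient 0 and, in [modE], remainder [m]. *)
Lemma divE m p : Nat.div m p = (m %/ p)%N.
Proof.
case: p => [|p]; first by rewrite divn0.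
symmetry; apply: (Nat.div_unique m p.+1 _ (m %% p.+1)%N); first by apply/ssrnat.ltP; rewrite ltn_mod.
by rewrite [LHS](divn_eq m p.+1) mulnC.
Qed.

Lemma modE m p : (Nat.modulo m p) = (m %% p)%N.
Proof.
case: p => [|p]; first by rewrite modn0.
symmetry; apply: (Nat.mod_unique m p.+1 (m %/ p.+1)%N); first by apply/ssrnat.ltP; rewrite ltn_mod.
by rewrite [LHS](divn_eq m p.+1) mulnC.
Qed.

Definition mxof m n (A : Mat) : 'M[CC]_(m, n) := \matrix_(i, j) toC (A i j).

Lemma mxof_eqP m n (A B : Mat) :
  mxof m n A = mxof m n B <-> forall i j, (i < m)%coq_nat -> (j < n)%coq_nat -> A i j = B i j.
Proof.
split=> [/matrixP h i j /ssrnat.ltP hi /ssrnat.ltP hj | h].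
  by have := h (Ordinal hi) (Ordinal hj); rewrite !mxE => /toC_inj.
by apply/matrixP => i j; rewrite !mxE h //; apply/ssrnat.ltP.
Qed.

Lemma mxofM m k n A B : mxof m n (Mmul k A B) = mxof m k A *m mxof k n B.
Proof.
apply/matrixP => i j; rewrite !mxE toC_sum; apply: eq_bigr => l _.
by rewrite !mxE toCM.
Qed.

Lemma mxofB m n A B : mxof m n (Msub A B) = mxof m n A - mxof m n B.
Proof. by apply/matrixP => i j; rewrite !mxE toCD toCN. Qed.

Lemma mxofZ m n c A : mxof m n (Mscale c A) = toC c *: mxof m n A.
Proof. by apply/matrixP => i j; rewrite !mxE toCM. Qed.

Lemma mxof_adj m n A : mxof n m (Madj A) = adjmx (mxof m n A).
Proof. by apply/matrixP => i j; rewrite !mxE toC_conj. Qed.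

Lemma toC_Mid i j : toC (Mid i j) = (i == j)%:R.
Proof. by rewrite /Mid; case: Nat.eqb_spec => [->|/eqP/negPf->]; rewrite ?eqxx. Qed.

Lemma mxof_id n : mxof n n Mid = 1%:M.
Proof. by apply/matrixP => i j; rewrite !mxE toC_Mid. Qed.

Lemma mxof_kron m n p q A B :
  mxof (m * p) (n * q) (kron p q A B) = mxof m n A *t mxof p q B.
Proof. by apply/matrixP => i j; rewrite !mxE /kron toCM !divE !modE. Qed.

Lemma toC_trace n A : toC (Mtrace n A) = \tr (mxof n n A).
Proof. by rewrite /Mtrace toC_sum; apply: eq_bigr => i _; rewrite mxE. Qed.

Lemma mxof_sum m n (T : Type) (f : T -> Mat) (l : list T) :
  mxof m n (Msum (List.map f l)) = \sum_(K <- l) mxof m n (f K).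
Proof.
elim: l => [|K l IH]; first by rewrite big_nil; apply/matrixP => i j; rewrite !mxE.
by rewrite big_cons -IH; apply/matrixP => i j; rewrite !mxE toCD.
Qed.

Lemma is_channelP m n (Ks : list Mat) :
  is_channel m n Ks <-> \sum_(K <- Ks) adjmx (mxof m n K) *m mxof m n K = 1%:M.
Proof.
rewrite -mxof_id; under eq_bigr do rewrite -mxof_adj -mxofM.
by rewrite -mxof_sum mxof_eqP.
Qed.

End Translation.

(** * Kraus operators of the protocol *)

Section Protocol.
Local Notation CC := (complex R).
Variables (d : nat) (c s : R).
Let cC : CC := Complex c 0.
Let sC : CC := Complex s 0.

(* [c (1 (x) <y|) - i s (<y| (x) 1)], from A (x) A1 to A. *)
Definition swap_kraus (y : nat) : Mat := fun a j =>
  Cadd (if Nat.eqb a (Nat.div j d) && Nat.eqb y (Nat.modulo j d) then mkC c 0 else C0)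
       (if Nat.eqb a (Nat.modulo j d) && Nat.eqb y (Nat.div j d) then mkC 0 (- s) else C0).

(** [K] acts on [A] and the earlier copies, the identity on the last copy, and [swap_kraus] then
    merges the two. Each [y] is a basis outcome on the discarded system, so there are d^n
    operators. *)
Fixpoint lmr_kraus (n : nat) : list Mat :=
  match n with
  | O => [:: Mid]
  | n'.+1 => [seq Mmul (d * d) (swap_kraus y) (kron d d K Mid) | K <- lmr_kraus n', y <- iota 0 d]
  end.

Lemma eqb_eqn m n : Nat.eqb m n = (m == n).
Proof. by apply/idP/eqP => /PeanoNat.Nat.eqb_eq. Qed.

Lemma swap_krausE (y a : nat) (j k : 'I_d) :
  toC (swap_kraus y a (mxtens_index (j, k))) =
  (a == j)%:R * (y == k)%:R * cC - (a == k)%:R * (y == j)%:R * ('i * sC).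
Proof.
have d0 : (0 < d)%N by case: d j => // -[].
rewrite /swap_kraus toCD divE modE !eqb_eqn /= divnMDl // divn_small // addn0 modnMDl modn_small //.
have -> : 'i * sC = toC (mkC 0 s).
  by rewrite -complexiE; apply/eqP; rewrite eq_complex /= !mul0r !mul1r !add0r ?oppr0 !eqxx.
have hN : toC (mkC 0 (- s)) = - toC (mkC 0 s) by rewrite -toCN /Copp /= Ropp_0.
by do 4!case: eqP => _; rewrite /= ?hN ?mul1r ?mul0r ?mulr0 ?toC0 ?oppr0 ?addr0 ?add0r.
Qed.

Let SK (y : 'I_d) := mxof d (d * d) (swap_kraus y).

Lemma mul_swap_kraus y n (M : 'M[CC]_(d * d, n)) a l :
  (SK y *m M) a l = cC * M (mxtens_index (a, y)) l - 'i * sC * M (mxtens_index (y, a)) l.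
Proof.
rewrite mxE big_mxtens.
under eq_bigr do under eq_bigr do rewrite mxE swap_krausE mulrBl.
under eq_bigr do rewrite sumrB.
rewrite sumrB; congr (_ - _).
  rewrite (bigD1 a) //= [X in _ + X]big1 ?addr0 => [|i ne].
    rewrite (bigD1 y) //= [X in _ + X]big1 ?addr0 => [|i ne].
      by rewrite !eqxx !mul1r.
    by rewrite ![_ == nat_of_ord i]eq_sym [nat_of_ord i == nat_of_ord y](negPf ne) mulr0 !mul0r.
  by apply: big1 => j _; rewrite [_ == nat_of_ord i]eq_sym [nat_of_ord i == nat_of_ord a](negPf ne) !mul0r.
rewrite (bigD1 y) //= [X in _ + X]big1 ?addr0 => [|i ne].
  rewrite (bigD1 a) //= [X in _ + X]big1 ?addr0 => [|i ne].
    by rewrite !eqxx !mul1r.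
  by rewrite ![_ == nat_of_ord i]eq_sym [nat_of_ord i == nat_of_ord a](negPf ne) !mul0r.
by apply: big1 => j _; rewrite [_ == nat_of_ord i]eq_sym [nat_of_ord i == nat_of_ord y](negPf ne) mulr0 !mul0r.
Qed.

(** [swapstep] for trivial [B], where the partial trace is a scalar. *)
Definition swapstep1 (r Y : 'M[CC]_d) : 'M[CC]_d :=
  cC ^+ 2 *: Y + (sC ^+ 2 * \tr Y) *: r - ('i * (cC * sC)) *: (r *m Y - Y *m r).

Let cR : cC^* = cC.
Proof. by rewrite /cC; congr Complex; rewrite oppr0. Qed.
Let sR : sC^* = sC.
Proof. by rewrite /sC; congr Complex; rewrite oppr0. Qed.

(** Summing over [y] traces out the discarded system: the diagonal terms produce tr r = 1 and tr Y,
    the cross terms the two matrix products. *)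
Lemma sum_swap_kraus (r Y : 'M[CC]_d) : \tr r = 1 ->
  \sum_y SK y *m (Y *t r) *m adjmx (SK y) = swapstep1 r Y.
Proof.
move=> r1; apply/matrixP => a a'; rewrite summxE.
have E y : (SK y *m (Y *t r) *m adjmx (SK y)) a a' =
  cC ^+ 2 * (Y a a' * r y y) + sC ^+ 2 * (r a a' * Y y y)
  + 'i * (cC * sC) * (Y a y * r y a') - 'i * (cC * sC) * (r a y * Y y a').
  (* A double adjoint turns multiplication on the right into multiplication on the left, so that
     [mul_swap_kraus] serves both sides. *)
  have -> : SK y *m (Y *t r) *m adjmx (SK y) = adjmx (SK y *m adjmx (SK y *m (Y *t r))).
    by rewrite adjmxM adjmxK.
  rewrite adjmxE mul_swap_kraus !adjmxE !mul_swap_kraus !tensmxE.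
  rewrite !(rmorphB, rmorphM) /= !conjCK conjCi cR sR.
  have ii : 'i * 'i = -1 :> CC by rewrite -expr2 sqrCi.
  transitivity (cC ^+ 2 * (Y a a' * r y y) - ('i * 'i) * sC ^+ 2 * (r a a' * Y y y)
  + 'i * (cC * sC) * (Y a y * r y a') - 'i * (cC * sC) * (r a y * Y y a')); first ring.
  by rewrite ii mulN1r mulNr opprK.
under eq_bigr do rewrite E.
rewrite sumrB !big_split /= -!mulr_sumr -/(\tr r) -/(\tr Y) r1 !mxE /mxtrace.
ring.
Qed.

(** Unitarity of c - i s S: the sum over [y] restores the full operator, its cross terms cancel, and
    S^2 = 1 leaves c^2 + s^2. *)
Lemma sum_adj_swap_kraus : c * c + s * s = 1 ->
  \sum_y adjmx (SK y) *m SK y = 1%:M.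
Proof.
move=> cs; apply/matrixP => i j; rewrite summxE.
case: (mxtens_indexP i) => i0 i1; case: (mxtens_indexP j) => j0 j1.
have cs1 : cC ^+ 2 + sC ^+ 2 = 1.
  by apply/eqP; rewrite !expr2 eq_complex /= !mulr0 !subr0 !mul0r !addr0 cs !eqxx.
have ii : 'i * 'i = -1 :> CC by rewrite -expr2 sqrCi.
have dl (x : 'I_d) (F : 'I_d -> CC) : \sum_y (y == x)%:R * F y = F x.
  rewrite (bigD1 x) //= eqxx mul1r big1 ?addr0 // => y /negPf ->; exact: mul0r.
transitivity (\sum_(y < d) \sum_(a < d)
  (((y == i1)%:R * ((a == i0)%:R * (cC ^+ 2 * ((a == j0)%:R * (y == j1)%:R))))
  + ((y == i0)%:R * ((a == i1)%:R * (sC ^+ 2 * ((a == j1)%:R * (y == j0)%:R))))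
  + ((y == i0)%:R * ((a == i1)%:R * ('i * cC * sC * ((a == j0)%:R * (y == j1)%:R))))
  - ((y == i1)%:R * ((a == i0)%:R * ('i * cC * sC * ((a == j1)%:R * (y == j0)%:R)))))).
  apply: eq_bigr => y _; rewrite mxE; apply: eq_bigr => a _.
  rewrite adjmxE !mxE !swap_krausE !(rmorphB, rmorphM, conjC_nat) /= conjCi cR sR !rmorph_nat.
  rewrite -!val_eqE /=.
  set x1 := (_ == _ :> nat)%:R; set x2 := (_ == _ :> nat)%:R.
  set x3 := (_ == _ :> nat)%:R; set x4 := (_ == _ :> nat)%:R.
  have -> : sC ^+ 2 = - ('i * 'i) * sC ^+ 2 by rewrite ii opprK mul1r.
  ring.
under eq_bigr do rewrite sumrB !big_split /= -!mulr_sumr !dl.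
rewrite sumrB !big_split /= !dl.
rewrite mxE (can_eq (@mxtens_indexK d d)) xpair_eqE -mulnb natrM.
transitivity ((cC ^+ 2 + sC ^+ 2) * ((i0 == j0)%:R * (i1 == j1)%:R)); first by ring.
by rewrite cs1 mul1r.
Qed.

Lemma lmr_kraus_channel n : c * c + s * s = 1 ->
  is_channel d (d * (Nat.pow d n)) (lmr_kraus n).
Proof.
move=> cs; apply/is_channelP; elim: n => [|n IH].
  by rewrite big_seq1 muln1 mxof_id adjmx1 mulmx1.
have -> : (d * (Nat.pow d n.+1))%N = (d * (Nat.pow d n) * d)%N.
  by rewrite mulnAC mulnA.
rewrite /= big_allpairs_dep /=.
move: (Nat.pow d n) IH => N IH.
transitivity (\sum_(K <- lmr_kraus n) (adjmx (mxof d (d * N) K) *m mxof d (d * N) K) *t (1%:M : 'M[CC]_d)).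
  apply: eq_bigr => K _; rewrite -[X in iota 0 X]subn0 -/(index_iota 0 d) big_mkord.
  transitivity (adjmx (mxof d (d * N) K *t 1%:M) *m (\sum_y adjmx (SK y) *m SK y) *m (mxof d (d * N) K *t (1%:M : 'M[CC]_d))).
    rewrite mulmx_sumr mulmx_suml; apply: eq_bigr => y _.
    by rewrite mxofM mxof_kron mxof_id adjmxM !mulmxA.
  by rewrite sum_adj_swap_kraus // mulmx1 adjmx_tens adjmx1 tensmx_mul mulmx1.
by rewrite -tensmx_suml IH tensmx11.
Qed.

End Protocol.

(** * The protocol output as an iterated step *)

Section ProtocolOutput.
Local Notation CC := (complex R).

(** Reconciles two groupings: the input keeps all copies in one factor, whereas [lmr_kraus] splits
    off the last. *)
Lemma kron_assoc N d X Y Z i j :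
  kron (N * d) (N * d) X (kron d d Y Z) i j = kron d d (kron N N X Y) Z i j.
Proof.
have dE k : (k %/ (N * d))%N = (k %/ d %/ N)%N by rewrite mulnC divnMA.
have mE k : (k %% (N * d) %% d)%N = (k %% d)%N by rewrite modn_dvdm // dvdn_mull.
have mdE k : (k %% (N * d) %/ d)%N = (k %/ d %% N)%N.
  case: d {dE mE} => [|d]; first by rewrite muln0 !divn0 mod0n.
  have [->|N0] := posnP N; first by rewrite mul0n !modn0.
  rewrite [in LHS](divn_eq k d.+1) [in LHS](divn_eq (k %/ d.+1) N) mulnDl -mulnA -addnA modnMDl.
  rewrite modn_small; first by rewrite divnMDl // (divn_small (ltn_pmod k (ltn0Sn d))) addn0.
  have h1 : (k %/ d.+1 %% N < N)%N by rewrite ltn_mod.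
  have h2 : (k %% d.+1 < d.+1)%N by rewrite ltn_mod.
  apply: (@leq_trans ((k %/ d.+1 %% N).+1 * d.+1)); first by rewrite mulSn addnC ltn_add2r.
  by rewrite leq_mul2r h1 orbT.
apply: toC_inj; rewrite /kron !toCM !divE !modE !dE !mE !mdE mulrA //.
Qed.

Variables (d : nat) (c s : R) (rho : Mat).
Let cC : CC := Complex c 0.
Let sC : CC := Complex s 0.
Let rhoC := mxof d d rho.
Hypothesis rho1 : \tr rhoC = 1.

(** Stated for an arbitrary matrix [X], since it is applied to the blocks of sigma, which are not
    states in general. *)
Lemma lmr_kraus_block n X :
  \sum_(K <- lmr_kraus d c s n)
     mxof d (d * Nat.pow d n) K
     *m mxof (d * Nat.pow d n) (d * Nat.pow d n) (kron (Nat.pow d n) (Nat.pow d n) X (tpow d rho n))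
     *m adjmx (mxof d (d * Nat.pow d n) K)
  = iter n (swapstep1 c s rhoC) (mxof d d X).
Proof.
elim: n => [|n IH].
  rewrite big_seq1 muln1 mxof_id adjmx1 mul1mx mulmx1 /=.
  apply/matrixP => i j; rewrite !mxE /kron toCM toC_Mid !divE !modE !modn1 !divn1.
  by rewrite mulr1.
have NE : Nat.pow d n.+1 = (Nat.pow d n * d)%N by rewrite mulnC.
rewrite /= -/(Nat.pow d n.+1) NE mulnA big_allpairs_dep /=.
move: (Nat.pow d n) IH => N IH {NE}.
have -> : mxof (d * N * d) (d * N * d) (kron (N * d) (N * d) X (kron d d (tpow d rho n) rho))
   = mxof (d * N) (d * N) (kron N N X (tpow d rho n)) *t rhoC.
  by rewrite -mxof_kron; apply/mxof_eqP => i j _ _; rewrite kron_assoc.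
set Z := mxof (d * N) _ _ in IH *.
rewrite -IH -sum_swap_kraus // exchange_big /=.
rewrite -[X in iota 0 X]subn0 -/(index_iota 0 d) big_mkord; apply: eq_bigr => y _.
rewrite tensmx_suml mulmx_sumr mulmx_suml; apply: eq_bigr => K _.
rewrite mxofM mxof_kron mxof_id !adjmxM adjmx_tens adjmx1 !mulmxA.
rewrite -(mulmxA (mxof _ _ _)) tensmx_mul -(mulmxA (mxof _ _ _)) tensmx_mul.
by rewrite mul1mx mulmx1.
Qed.

(** The operator <x| X |y> on [A] for basis vectors of [B]; unlike [diagblock], it fixes the indices
    of the second factor. *)
Definition block b (X : 'M[CC]_(d * b)) (x y : 'I_b) : 'M[CC]_d :=
  \matrix_(i, j) X (mxtens_index (i, x)) (mxtens_index (j, y)).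

Lemma block_inj b (X Y : 'M[CC]_(d * b)) :
  (forall x y, block X x y = block Y x y) -> X = Y.
Proof.
move=> h; apply/matrixP => i j.
case: (mxtens_indexP i) => i0 i1; case: (mxtens_indexP j) => j0 j1.
by have /matrixP/(_ i0 j0) := h i1 j1; rewrite !mxE.
Qed.

(** Multiplication by rho (x) 1 leaves the [B] indices alone, and entry (x, y) of the partial trace
    is the trace of block (x, y). *)
Lemma block_swapstep b (X : 'M[CC]_(d * b)) x y :
  block (swapstep cC sC rhoC X) x y = swapstep1 c s rhoC (block X x y).
Proof.
apply/matrixP => i j; rewrite !mxE !mxtens_indexK /=.
have -> : \sum_k X (mxtens_index (k, x)) (mxtens_index (k, y)) = \tr (block X x y).
  by apply: eq_bigr => k _; rewrite mxE.
rewrite !big_mxtens.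
have -> : \sum_i0 \sum_j0 (rhoC *t 1%:M) (mxtens_index (i, x)) (mxtens_index (i0, j0)) *
     X (mxtens_index (i0, j0)) (mxtens_index (j, y)) = \sum_k rhoC i k * block X x y k j.
  apply: eq_bigr => k _; rewrite (bigD1 x) //= big1 ?addr0 => [|z ne].
    by rewrite tensmxE !mxE eqxx mulr1.
  by rewrite tensmxE !mxE eq_sym (negPf ne) mulr0 mul0r.
have -> : \sum_i0 \sum_j0 X (mxtens_index (i, x)) (mxtens_index (i0, j0)) *
     (rhoC *t 1%:M) (mxtens_index (i0, j0)) (mxtens_index (j, y)) = \sum_k block X x y i k * rhoC k j.
  apply: eq_bigr => k _; rewrite (bigD1 y) //= big1 ?addr0 => [|z ne].
    by rewrite tensmxE !mxE eqxx mulr1.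
  by rewrite tensmxE !mxE (negPf ne) !mulr0.
rewrite -/cC -/sC -(mulrA (sC ^+ 2)); congr (_ + _ * _ - _).
exact: mulrC.
Qed.

(** The equality test in [lift_kraus] selects one index of [B]; the sums over [A] and the copies
    remain. *)
Lemma mul_lift_kraus b N K n (M : 'M[CC]_(d * b * N, n)) a x l :
  (mxof (d * b) (d * b * N) (lift_kraus b N K) *m M) (mxtens_index (a, x)) l =
  \sum_(j < d) \sum_(k < N) toC (K a (j * N + k)%N) * M (mxtens_index (mxtens_index (j, x), k)) l.
Proof.
rewrite mxE !big_mxtens; apply: eq_bigr => j _.
rewrite (bigD1 x) //= [X in _ + X]big1 ?addr0 => [|z ne].
  apply: eq_bigr => k _; rewrite mxE /lift_kraus !divE !modE eqb_eqn /=.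
  have N0 : (0 < N)%N by apply: leq_trans (ltn_ord k).
  have b0 : (0 < b)%N by apply: leq_trans (ltn_ord x).
  rewrite !divnMDl // (divn_small (ltn_ord k)) addn0 !divnMDl // (divn_small (ltn_ord x)) !addn0.
  by rewrite !modnMDl (modn_small (ltn_ord k)) (modn_small (ltn_ord x)) eqxx.
apply: big1 => k _; rewrite mxE /lift_kraus !divE !modE eqb_eqn /=.
have N0 : (0 < N)%N by apply: leq_trans (ltn_ord k).
have b0 : (0 < b)%N by apply: leq_trans (ltn_ord x).
rewrite !divnMDl // (divn_small (ltn_ord k)) addn0 !modnMDl.
rewrite (modn_small (ltn_ord x)) (modn_small (ltn_ord z)).
by rewrite eq_sym [nat_of_ord z == _](negPf ne) mul0r.
Qed.

Lemma block_lift_kraus b N K (sigma Y : Mat) (x y : 'I_b) :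
  block (mxof (d * b) (d * b) (let L := lift_kraus b N K in
      Mmul (d * b * N) (Mmul (d * b * N) L (kron N N sigma Y)) (Madj L))) x y =
  mxof d (d * N) K
  *m mxof (d * N) (d * N) (kron N N (fun i j => sigma (i * b + x)%N (j * b + y)%N) Y)
  *m adjmx (mxof d (d * N) K).
Proof.
rewrite /= !mxofM mxof_adj !mxof_kron.
set L := mxof _ _ (lift_kraus _ _ _); set S := mxof (d * b) _ sigma; set T := mxof N N Y.
set S' := mxof d d _; set KK := mxof d _ K.
have -> : L *m (S *t T) *m adjmx L = adjmx (L *m adjmx (L *m (S *t T))) by rewrite adjmxM adjmxK.
have -> : KK *m (S' *t T) *m adjmx KK = adjmx (KK *m adjmx (KK *m (S' *t T))) by rewrite adjmxM adjmxK.
apply/matrixP => i j; rewrite mxE !adjmxE; congr (_ ^*).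
rewrite mul_lift_kraus mxE big_mxtens; apply: eq_bigr => j' _; apply: eq_bigr => k' _.
rewrite [X in _ = X * _]mxE; congr (_ * _); rewrite !adjmxE; congr (_ ^*).
rewrite mul_lift_kraus mxE big_mxtens; apply: eq_bigr => i' _; apply: eq_bigr => k _.
by rewrite [X in _ = X * _]mxE !tensmxE !mxE.
Qed.

(** Entanglement with [B] costs nothing: on each block the lifted protocol is the one on [A], and
    the blocks determine the matrix. *)
Lemma mxof_apply_lifted b n (sigma : Mat) :
  mxof (d * b) (d * b)
    (apply_lifted (d * b * Nat.pow d n) b (Nat.pow d n) (lmr_kraus d c s n)
      (kron (Nat.pow d n) (Nat.pow d n) sigma (tpow d rho n)))
  = iter n (swapstep cC sC rhoC) (mxof (d * b) (d * b) sigma).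
Proof.
apply: block_inj => x y; rewrite /apply_lifted mxof_sum.
have -> : block (iter n (swapstep cC sC rhoC) (mxof (d * b) (d * b) sigma)) x y =
    iter n (swapstep1 c s rhoC) (mxof d d (fun i j => sigma (i * b + x)%N (j * b + y)%N)).
  elim: n => [|n IH]; first by apply/matrixP => i j; rewrite !mxE.
  by rewrite /= block_swapstep IH.
rewrite -lmr_kraus_block.
transitivity (\sum_(K <- lmr_kraus d c s n) block (mxof (d * b) (d * b)
   (let L := lift_kraus b (Nat.pow d n) K in
      Mmul (d * b * Nat.pow d n) (Mmul (d * b * Nat.pow d n) L
       (kron (Nat.pow d n) (Nat.pow d n) sigma (tpow d rho n))) (Madj L))) x y).
  by apply/matrixP => i j; rewrite mxE !summxE; apply: eq_bigr => K _; rewrite [RHS]mxE.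
by apply: eq_bigr => K _; rewrite block_lift_kraus.
Qed.

End ProtocolOutput.

(** * Spectra of density operators and unit phases *)

Section Spectral.
Local Notation CC := (complex R).

Definition ofC (z : CC) : Defs.C := mkC (complex.Re z) (complex.Im z).

Lemma ofCK : cancel ofC toC. Proof. by case. Qed.

Definition Mat_of n (M : 'M[CC]_n) : Mat := fun i j =>
  if (insub i, insub j) is (Some i', Some j') then ofC (M i' j') else C0.

Lemma Mat_ofK n (M : 'M[CC]_n) : mxof n n (Mat_of M) = M.
Proof. by apply/matrixP => i j; rewrite mxE /Mat_of !valK ofCK. Qed.

Lemma quadratic_form_mxof n (A : Mat) (v : nat -> Defs.C) :
  toC (Csum n (fun i => Csum n (fun j => Cmul (Cconj (v i)) (Cmul (A i j) (v j))))) =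
  (adjmx (\col_(i < n) toC (v i)) *m mxof n n A *m \col_(i < n) toC (v i)) 0 0.
Proof.
rewrite -mulmxA mxE toC_sum; apply: eq_bigr => i _.
rewrite toC_sum adjmxE !mxE mulr_sumr; apply: eq_bigr => j _.
by rewrite !mxE !toCM toC_conj.
Qed.

Lemma MhermitianP n (A : Mat) : Mhermitian n A <-> adjmx (mxof n n A) = mxof n n A.
Proof.
rewrite -mxof_adj mxof_eqP /Mhermitian; split=> h i j hi hj.
  by rewrite /Madj -h.
by rewrite -[RHS]/(Madj A i j) h.
Qed.

Lemma MpsdP n (A : Mat) : Mpsd n A <->
  adjmx (mxof n n A) = mxof n n A /\
  forall v : 'cV[CC]_n, 0 <= complex.Re ((adjmx v *m mxof n n A *m v) 0 0).
Proof.
rewrite /Mpsd MhermitianP; split=> -[hA h]; split=> // v.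
  pose w (i : nat) := if insub i is Some j then ofC (v j 0) else C0.
  have -> : v = \col_(i < n) toC (w i).
    by apply/colP => i; rewrite mxE /w valK ofCK.
  by rewrite -quadratic_form_mxof; apply/RleP; apply: h.
by have := h (\col_(i < n) toC (v i)); rewrite -quadratic_form_mxof => /RleP.
Qed.

Lemma complex_ge0 (z : CC) : z \is Num.real -> 0 <= complex.Re z -> 0 <= z.
Proof. by move=> zr; rewrite -{2}(RRe_real zr) ler0c. Qed.

Lemma conj_diagE n (P : 'M[CC]_n) (p : 'rV[CC]_n) i j :
  (adjmx P *m diag_mx p *m P) i j = \sum_k (P k i)^* * P k j * p 0 k.
Proof.
rewrite mul_mx_diag mxE; apply: eq_bigr => k _.
by rewrite !mxE mulrAC.
Qed.

Lemma density_diagonalization n (rho : Mat) : density n rho ->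
  exists (P : 'M[CC]_n) (p : 'rV[CC]_n),
    [/\ P *m adjmx P = 1%:M, mxof n n rho = adjmx P *m diag_mx p *m P,
        forall i, 0 <= p 0 i & \sum_i p 0 i = 1].
Proof.
move=> [/MpsdP[hr hpos] tr1].
have [P [p [PP PP' er preal]]] := hermitian_diagonalization hr.
exists P, p; split=> // [i|].
  apply: complex_ge0 => //.
  (* The test vector is the eigenvector of index [i], whose quadratic form is the eigenvalue. *)
  have := hpos (adjmx P *m delta_mx i 0).
  rewrite er adjmxM adjmxK !mulmxA -(mulmxA _ P) PP mulmx1 -!(mulmxA _ P) PP mulmx1.
  congr (_ <= complex.Re _); rewrite mul_mx_diag -colE.
  by rewrite !mxE !eqxx conjC1 mul1r.
by rewrite -mxtrace_diag -toC1 -tr1 toC_trace er mxtrace_mulC mulmxA PP mul1mx.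
Qed.

(** This is exp(- i theta), with the sign of the target evolution. *)
Definition expi (theta : R) : CC := Complex (cos theta) (- sin theta).
#[global] Arguments expi theta%_ring_scope.

Lemma expiD a b : expi (a + b) = expi a * expi b.
Proof.
rewrite /expi; apply/eqP; rewrite eq_complex /=; apply/andP; split; apply/eqP.
  by rewrite -[cos _]/(cos (Rplus a b)) cos_plus !RmultE RminusE; ring.
by rewrite -[sin _]/(sin (Rplus a b)) sin_plus !RmultE RplusE; ring.
Qed.

Lemma expi0 : expi 0 = 1.
Proof. by rewrite /expi (cos_0 : cos 0 = 1) (sin_0 : sin 0 = 0) oppr0. Qed.

Lemma mul_expi_conj theta : expi theta * (expi theta)^* = 1.
Proof.
have := sin2_cos2 theta; rewrite /Rsqr RplusE !RmultE => h.
apply/eqP; rewrite eq_complex /= opprK; apply/andP; split; apply/eqP; last by ring.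
by rewrite -[RHS]h; ring.
Qed.

Lemma norm_expi theta : `|expi theta| = 1.
Proof. by apply/eqP; rewrite -(@eqrXn2 _ 2) // expr1n normCK mul_expi_conj. Qed.

Lemma normc_le (a b e f : R) : `|a| <= e -> `|b| <= f -> `|Complex a b| <= Complex (e + f) 0.
Proof.
move=> ha hb.
have -> : Complex a b = Complex a 0 + 'i * Complex b 0.
  by rewrite -complexiE; apply/eqP; rewrite eq_complex /= !mul0r !mul1r !add0r oppr0 !addr0 !eqxx.
have -> : Complex (e + f) 0 = Complex e 0 + Complex f 0.
  by apply/eqP; rewrite eq_complex /= addr0 !eqxx.
apply: le_trans (ler_normD _ _) _; rewrite normrM normCi mul1r.
by apply: lerD; rewrite normc_def /= expr0n /= addr0 sqrtr_sqr lecR.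
Qed.

(** One theta^2 for the cosine and one for the sine: the origin of the factor 2 in the bound on
    [Q]. *)
Lemma expi_taylor (theta : R) : `|theta| <= 1 ->
  `|expi theta - 1 + 'i * Complex theta 0| <= 2 * Complex (theta ^+ 2) 0.
Proof.
move=> h.
have -> : expi theta - 1 + 'i * Complex theta 0 = Complex (cos theta - 1) (- (sin theta - theta)).
  rewrite -complexiE; apply/eqP; rewrite eq_complex /=.
  by apply/andP; split; apply/eqP; ring.
have -> : 2 * Complex (theta ^+ 2) 0 = Complex (theta ^+ 2 + theta ^+ 2) 0 :> CC.
  by rewrite mulrDl mul1r; apply/eqP; rewrite eq_complex /= addr0 !eqxx.
apply: normc_le.
  by have /RleP := cos_quadratic_bound theta; rewrite RabsE RpowE.
have hR : Rle (Rabs theta) 1 by apply/RleP; rewrite RabsE.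
by rewrite normrN; have /RleP := sin_linear_bound theta hR; rewrite RabsE RpowE.
Qed.

End Spectral.

(** * Limits of complex sequences *)

Section ComplexLimits.
Local Notation CC := (complex R).

Definition Ccv (u : nat -> CC) (l : CC) :=
  Un_cv (fun n => complex.Re (u n)) (complex.Re l) /\
  Un_cv (fun n => complex.Im (u n)) (complex.Im l).

Lemma Ccv_unique u l l' : Ccv u l -> Ccv u l' -> l = l'.
Proof.
case: l l' => a b [a' b'] [/= h1 h2] [/= h3 h4].
by rewrite (UL_sequence _ _ _ h1 h3) (UL_sequence _ _ _ h2 h4).
Qed.

Lemma Un_cv_cst (a : R) : Un_cv (fun _ => a) a.
Proof.
by move=> eps he; exists 0%N => n _; rewrite /Rdist Rminus_diag Rabs_R0.
Qed.

Lemma Ccv_cst l : Ccv (fun _ => l) l.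
Proof. by split; apply: Un_cv_cst. Qed.

Lemma CcvD u v l k : Ccv u l -> Ccv v k -> Ccv (fun n => u n + v n) (l + k).
Proof.
case: l k => a b [a' b'] [/= h1 h2] [/= h3 h4]; split.
  apply: Un_cv_ext (CV_plus _ _ _ _ h1 h3) => n.
  by case: (u n) (v n) => ? ? [].
apply: Un_cv_ext (CV_plus _ _ _ _ h2 h4) => n.
by case: (u n) (v n) => ? ? [].
Qed.

Lemma CcvM u v l k : Ccv u l -> Ccv v k -> Ccv (fun n => u n * v n) (l * k).
Proof.
case: l k => a b [a' b'] [/= h1 h2] [/= h3 h4]; split.
  apply: Un_cv_ext (CV_minus _ _ _ _ (CV_mult _ _ _ _ h1 h3) (CV_mult _ _ _ _ h2 h4)) => n.
  by case: (u n) (v n) => ? ? [].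
apply: Un_cv_ext (CV_plus _ _ _ _ (CV_mult _ _ _ _ h1 h4) (CV_mult _ _ _ _ h2 h3)) => n.
by case: (u n) (v n) => ? ? [].
Qed.

Lemma Ccv_sum m (u : 'I_m -> nat -> CC) (l : 'I_m -> CC) :
  (forall i, Ccv (u i) (l i)) -> Ccv (fun n => \sum_i u i n) (\sum_i l i).
Proof.
elim: m u l => [|m IH] u l h.
  have := Ccv_cst 0; rewrite big_ord0; congr Ccv.
  by apply: boolp.funext => n; rewrite big_ord0.
have := CcvD (IH _ _ (fun i => h (widen_ord (leqnSn m) i))) (h ord_max).
rewrite big_ord_recr /=; congr Ccv.
by apply: boolp.funext => n; rewrite big_ord_recr.
Qed.

End ComplexLimits.

(** * The matrix exponential in an eigenbasis *)

Section MatrixExponential.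
Local Notation CC := (complex R).

Lemma conj_diagM n (P : 'M[CC]_n) (a b : 'rV[CC]_n) : P *m adjmx P = 1%:M ->
  (adjmx P *m diag_mx a *m P) *m (adjmx P *m diag_mx b *m P) =
  adjmx P *m diag_mx (\row_i (a 0 i * b 0 i)) *m P.
Proof.
move=> PP; rewrite !mulmxA -(mulmxA _ P) PP mulmx1 -(mulmxA _ (diag_mx a)).
by rewrite mulmx_diag.
Qed.

Lemma adjmx_conj_diag n (P : 'M[CC]_n) (a : 'rV[CC]_n) :
  adjmx (adjmx P *m diag_mx a *m P) = adjmx P *m diag_mx (map_mx Num.conj a) *m P.
Proof. by rewrite !adjmxM adjmxK adjmx_diag mulmxA. Qed.

Lemma mxof_Mpow n (M : Mat) (P : 'M[CC]_n) (q : 'rV[CC]_n) k :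
  P *m adjmx P = 1%:M -> mxof n n M = adjmx P *m diag_mx q *m P ->
  mxof n n (Mpow n M k) = adjmx P *m diag_mx (\row_i q 0 i ^+ k) *m P.
Proof.
move=> PP hM; elim: k => [|k IH] /=.
  rewrite mxof_id (_ : \row_i _ = const_mx 1); last by apply/rowP => i; rewrite !mxE.
  by rewrite diag_const_mx mulmx1 (mulmx1C PP).
rewrite mxofM IH hM (conj_diagM _ _ PP); congr (adjmx P *m diag_mx _ *m P).
by apply/rowP => i; rewrite !mxE exprSr.
Qed.

Lemma toC_Cpow x k : toC (Cpow x k) = toC x ^+ k.
Proof. by elim: k => [|k IH] //=; rewrite toCM IH exprSr. Qed.

Lemma expm_partial_entry n (M : Mat) (P : 'M[CC]_n) (x : nat -> Defs.C) N (i j : 'I_n) :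
  P *m adjmx P = 1%:M -> mxof n n M = adjmx P *m diag_mx (\row_l toC (x l)) *m P ->
  toC (expm_partial n M N i j) = \sum_l (P l i)^* * P l j *
    toC (Cexp_partial (x l) N).
Proof.
move=> PP hM; rewrite /expm_partial toC_sum.
transitivity (\sum_(k < N.+1) \sum_l (P l i)^* * P l j *
   (toC (mkC (Rinv (INR (fact k))) 0) * toC (x l) ^+ k)).
  apply: eq_bigr => k _; rewrite toCM.
  have := mxof_Mpow k PP hM; move/matrixP/(_ i j); rewrite conj_diagE mxE => ->.
  by rewrite mulr_sumr; apply: eq_bigr => l _; rewrite !mxE mulrCA.
rewrite exchange_big; apply: eq_bigr => l _; rewrite toC_sum mulr_sumr.
by apply: eq_bigr => k _; rewrite toCM toC_Cpow.
Qed.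

(** [U] is known only as an entrywise limit. In the eigenbasis of rho the partial sums become scalar
    ones, and uniqueness of limits along the odd indices identifies [U]. *)
Lemma mxof_Mexp n (rho U : Mat) (t : R) (P : 'M[CC]_n) (p : 'rV[CC]_n) :
  P *m adjmx P = 1%:M -> (forall i, p 0 i \is Num.real) ->
  mxof n n rho = adjmx P *m diag_mx p *m P ->
  Mexp_is n (Mscale (mkC 0 (- t)) rho) U ->
  mxof n n U = adjmx P *m diag_mx (\row_l expi (t * complex.Re (p 0 l))) *m P.
Proof.
move=> PP preal hr hU.
pose th (l : nat) : R := if insub l is Some l' then t * complex.Re (p 0 l') else 0.
have thE (l : 'I_n) : th l = t * complex.Re (p 0 l) by rewrite /th valK.
pose x (l : nat) := mkC 0 (Ropp (th l)).
have hM : mxof n n (Mscale (mkC 0 (- t)) rho) = adjmx P *m diag_mx (\row_l toC (x l)) *m P.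
  rewrite mxofZ hr scalemxAl scalemxAr -linearZ /=; congr (adjmx P *m diag_mx _ *m P).
  apply/rowP => l; rewrite !mxE /x thE -(RRe_real (preal l)).
  by apply/eqP; rewrite eq_complex /= !mul0r !mulr0 !add0r oppr0 mulNr !eqxx.
apply/matrixP => i j; rewrite mxE conj_diagE.
apply: (@Ccv_unique (fun m => toC (expm_partial n (Mscale (mkC 0 (- t)) rho) (Nat.add (Nat.mul 2 m) 1) i j))).
  have [h1 h2] := hU i j (elimT ssrnat.ltP (ltn_ord i)) (elimT ssrnat.ltP (ltn_ord j)).
  by split=> eps he; [have [N hN] := h1 eps he | have [N hN] := h2 eps he];
    exists N => m hm; apply: hN; lia.
have := @Ccv_sum n (fun l m => (P l i)^* * P l j *
    toC (Cexp_partial (x l) (Nat.add (Nat.mul 2 m) 1)))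
   (fun l => (P l i)^* * P l j * expi (th l)).
have cvl (l : 'I_n) : Ccv (fun m => (P l i)^* * P l j *
    toC (Cexp_partial (x l) (Nat.add (Nat.mul 2 m) 1)))
   ((P l i)^* * P l j * expi (th l)).
  have h : Ccv (fun m => toC (Cexp_partial (x l) (Nat.add (Nat.mul 2 m) 1))) (expi (th l)) := exp_imaginary_cv (th l).
  exact: (CcvM (Ccv_cst _) h).
move=> /(_ cvl); congr Ccv; last by apply: eq_bigr => l _; rewrite mxE thE.
by apply: boolp.funext => m; rewrite (expm_partial_entry _ _ _ PP hM).
Qed.

End MatrixExponential.

(** * From the dual bound to the trace norm *)

Section TraceNorm.
Local Notation CC := (complex R).

(** [S] is |D|, the square root required by [trnorm]. The contraction [W] of eigenvalue signs
    satisfies W D = |D|, so testing against it bounds the trace of |D| by [e]. *)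
Lemma trnorm_hermitian n (D : Mat) (e : R) :
  adjmx (mxof n n D) = mxof n n D -> trbound (mxof n n D) (Complex e 0) ->
  exists2 x : R, trnorm n D x & x <= e.
Proof.
move=> hD hb.
have [P [m [PP PP' eD _]]] := hermitian_diagonalization hD.
pose S := adjmx P *m diag_mx (\row_i `|m 0 i|) *m P.
(* At a zero eigenvalue the quotient is 0 / 0 = 0, so [W] is a contraction but not always
   unitary. *)
pose W := adjmx P *m diag_mx (\row_i ((m 0 i)^* / `|m 0 i|)) *m P.
have trS : \tr S = \sum_i `|m 0 i|.
  rewrite mxtrace_mulC mulmxA PP mul1mx mxtrace_diag; apply: eq_bigr => i _.
  by rewrite mxE.
have nrm (z : CC) : z^* / `|z| * z = `|z|.
  have [->|z0] := eqVneq z 0; first by rewrite mulr0 normr0.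
  by rewrite mulrAC [z^* * z]mulrC -normCK expr2 mulfK // normr_eq0.
exists (complex.Re (\tr S)); first exists (Mat_of S); first split; last first.
- have WD : W *m mxof n n D = S.
    rewrite eD (conj_diagM _ _ PP); congr (adjmx P *m diag_mx _ *m P).
    by apply/rowP => i; rewrite !mxE nrm.
  have /hb : opbound 1 W.
    apply: opbound_conj_diag => // i; rewrite mxE normrM normfV norm_conjC normr_id.
    have [->|z0] := eqVneq `|m 0 i| 0; first by rewrite mul0r.
    by rewrite divff.
  rewrite WD mul1r trS ger0_norm ?sumr_ge0 // => [].
  by rewrite lecE => /andP[].
- split; last by rewrite -[re _]/(complex.Re (toC _)) toC_trace Mat_ofK.
  apply/mxof_eqP; rewrite !mxofM mxof_adj Mat_ofK eD adjmx_conj_diag !(conj_diagM _ _ PP).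
  congr (adjmx P *m diag_mx _ *m P).
  by apply/rowP => i; rewrite !mxE -expr2 normCK.
- apply/MpsdP; rewrite Mat_ofK; split.
    rewrite adjmx_conj_diag; congr (adjmx P *m diag_mx _ *m P).
    by apply/rowP => i; rewrite !mxE; apply/CrealP; rewrite normr_real.
  move=> v.
  have -> : adjmx v *m S *m v = adjmx (P *m v) *m diag_mx (\row_i `|m 0 i|) *m (P *m v).
    by rewrite adjmxM !mulmxA.
  suff : 0 <= (adjmx (P *m v) *m diag_mx (\row_i `|m 0 i|) *m (P *m v)) 0 0.
    by rewrite lecE => /andP[].
  rewrite mul_mx_diag mxE; apply: sumr_ge0 => i _; rewrite mxE adjmxE [X in _ * X * _]mxE.
  by rewrite mulrAC mulrC mulr_ge0 // mulrC -normCK exprn_ge0.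
Qed.

End TraceNorm.

(** * The unitary group generated by a Hermitian matrix *)

Section ConjugationPowers.
Local Notation CC := (complex R).

(** Phrased for a family [A] instead of powers of one matrix; it is applied to k -> exp(- i k s rho)
    (x) 1. *)
Lemma iter_conjmx m (A : nat -> 'M[CC]_m) X k :
  A 0%N = 1%:M -> (forall j, A j.+1 = A 1%N *m A j) ->
  iter k (fun Y => A 1%N *m Y *m adjmx (A 1%N)) X = A k *m X *m adjmx (A k).
Proof.
move=> A0 AS; elim: k => [|k IH] /=; first by rewrite A0 adjmx1 mul1mx mulmx1.
by rewrite IH (AS k) adjmxM !mulmxA.
Qed.

(* [exp (- i theta H)] for the Hermitian matrix [H = P^* diag(p) P]. *)
Definition expi_mx m (P : 'M[CC]_m) (p : 'rV[CC]_m) (theta : R) : 'M[CC]_m :=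
  adjmx P *m diag_mx (\row_l expi (theta * complex.Re (p 0 l))) *m P.
#[global] Arguments expi_mx m P p theta%_ring_scope.

Lemma expi_mx0 m (P : 'M[CC]_m) p : P *m adjmx P = 1%:M -> expi_mx P p 0 = 1%:M.
Proof.
move=> PP; have e : \row_l expi (0 * complex.Re (p 0 l)) = const_mx 1.
  by apply/rowP => l; rewrite !mxE mul0r expi0.
by rewrite /expi_mx e diag_const_mx mulmx1 (mulmx1C PP).
Qed.

Lemma expi_mxD m (P : 'M[CC]_m) p a b : P *m adjmx P = 1%:M ->
  expi_mx P p (a + b) = expi_mx P p a *m expi_mx P p b.
Proof.
move=> PP; rewrite /expi_mx (conj_diagM _ _ PP).
have -> // : \row_l expi ((a + b) * complex.Re (p 0 l)) =
  \row_l ((\row_i expi (a * complex.Re (p 0 i))) 0 l * (\row_i expi (b * complex.Re (p 0 i))) 0 l).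
by apply/rowP => l; rewrite !mxE -expiD mulrDl.
Qed.

(** The factor [1%:R * s] stays unreduced to match the recursion A (k + 1) = A 1 A k literally. *)
Lemma expi_mx_tensS m b (s : R) (P : 'M[CC]_m) p k : P *m adjmx P = 1%:M ->
  expi_mx P p (k.+1%:R * s) *t (1%:M : 'M_b) =
  (expi_mx P p (1%:R * s) *t 1%:M) *m (expi_mx P p (k%:R * s) *t 1%:M).
Proof.
move=> PP; have -> : k.+1%:R * s = 1%:R * s + k%:R * s by rewrite -mulrDl -natrD add1n.
by rewrite (expi_mxD _ _ _ PP) tensmx_mul mulmx1.
Qed.

Lemma opbound_expi_mx m (P : 'M[CC]_m) p a : P *m adjmx P = 1%:M -> opbound 1 (expi_mx P p a).
Proof. by move=> PP; apply: opbound_conj_diag => // l; rewrite mxE norm_expi. Qed.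

Lemma opbound_adj_expi_mx m (P : 'M[CC]_m) p a :
  P *m adjmx P = 1%:M -> opbound 1 (adjmx (expi_mx P p a)).
Proof.
move=> PP; rewrite adjmx_conj_diag.
by apply: opbound_conj_diag => // l; rewrite !mxE norm_conjC norm_expi.
Qed.

End ConjugationPowers.

(** * Error of the whole protocol *)

Section LMRError.
Local Notation CC := (complex R).
Variables (dA dB n : nat) (c s t : R) (rho sigma U : Mat).
Hypothesis hrho : density dA rho.
Hypothesis hsigma : density (dA * dB) sigma.
Hypothesis hU : Mexp_is dA (Mscale (mkC 0 (- t)) rho) U.

Let D := Msub
   (Mmul (dA * dB) (Mmul (dA * dB) (kron dB dB U Mid) sigma) (Madj (kron dB dB U Mid)))
   (apply_lifted (dA * dB * Nat.pow dA n) dB (Nat.pow dA n) (lmr_kraus dA c s n)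
      (kron (Nat.pow dA n) (Nat.pow dA n) sigma (tpow dA rho n))).
Let cC : CC := Complex c 0.
Let sC : CC := Complex s 0.
Let rhoC := mxof dA dA rho.
Let sigmaC := mxof (dA * dB) (dA * dB) sigma.
Let UB := mxof dA dA U *t (1%:M : 'M[CC]_dB).

Let mxofD : mxof (dA * dB) (dA * dB) D =
  UB *m sigmaC *m adjmx UB - iter n (swapstep cC sC rhoC) sigmaC.
Proof.
have rho1 : \tr rhoC = 1 by rewrite -toC_trace; case: hrho => _ ->.
rewrite mxofB (mxof_apply_lifted c s rho1); congr (_ - _).
by rewrite !mxofM mxof_adj !mxof_kron mxof_id.
Qed.

Let Complex_real (a : R) : Complex a 0 \is @Num.real CC.
Proof. by apply/complex_realP; exists a. Qed.

Let D_hermitian : adjmx (mxof (dA * dB) (dA * dB) D) = mxof (dA * dB) (dA * dB) D.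
Proof.
have [[/MhermitianP hr _] _] := hrho; have [[/MhermitianP hs _] _] := hsigma.
rewrite mxofD adjmxB !adjmxM adjmxK -/sigmaC hs mulmxA; congr (_ - _).
elim: n => [|k IH] /=; first exact: hs.
by apply: adjmx_swapstep => //; apply: Complex_real.
Qed.

Let sigma_bound : trbound sigmaC 1.
Proof.
have [P [p [PP eP p0 p1]]] := density_diagonalization hsigma.
by rewrite /sigmaC eP; apply: trbound_conj_diag.
Qed.

(** Without copies the output is sigma, and two matrices of trace norm at most 1 are at distance at
    most 2. *)
Lemma lmr_trivial_error : n = 0%N -> exists2 x : R, trnorm (dA * dB) D x & x <= 2.
Proof.
move=> n0; apply: trnorm_hermitian D_hermitian _.
have [P [p [PP eP p0 _]]] := density_diagonalization hrho.
have eU : mxof dA dA U = expi_mx P p t := mxof_Mexp PP (fun i => ger0_real (p0 i)) eP hU.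
have hUB : opbound 1 UB.
  by apply: opbound_tensmx1; rewrite eU; apply: opbound_expi_mx.
have hUB' : opbound 1 (adjmx UB).
  by rewrite adjmx_tens adjmx1; apply: opbound_tensmx1; rewrite eU; apply: opbound_adj_expi_mx.
rewrite mxofD n0 /=.
have := trboundB (trbound_mulr hUB' (trbound_mull hUB sigma_bound)) sigma_bound.
rewrite !mul1r; apply: trbound_le.
by rewrite lecE /= addr0 eqxx lexx.
Qed.

(** V = exp(- i s rho) and the remainder [Q] are diagonal in the eigenbasis of rho, so their bounds
    reduce to scalar ones; n s = t turns the n-fold conjugation into the one by [U]. *)
Lemma lmr_error : n%:R * s = t -> s ^+ 2 <= 1 -> 0 <= c -> c ^+ 2 = 1 - s ^+ 2 ->
  exists2 x : R, trnorm (dA * dB) D x & x <= (1 + 13 * s ^+ 2) ^+ n - 1.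
Proof.
move=> ns s1 c0 cs1.
have css : `|c * s - s| <= s ^+ 2.
  apply/RleP; rewrite -RabsE -RpowE; apply: sqrt_sine_bound.
  - exact/RleP.
  - by rewrite RpowE; apply/RleP.
  - by rewrite !RpowE.
 apply: trnorm_hermitian D_hermitian _.
have [P [p [PP eP p0 p1]]] := density_diagonalization hrho.
have eU : mxof dA dA U = expi_mx P p t := mxof_Mexp PP (fun i => ger0_real (p0 i)) eP hU.
pose V := expi_mx P p s.
pose q : 'rV[CC]_dA := \row_l (expi (s * complex.Re (p 0 l)) - 1 + 'i * sC * p 0 l).
have eQ : V - 1%:M + ('i * sC) *: (adjmx P *m diag_mx p *m P) = adjmx P *m diag_mx q *m P.
  have -> : 1%:M = adjmx P *m diag_mx (const_mx 1) *m P.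
    by rewrite diag_const_mx mulmx1 (mulmx1C PP).
  rewrite scalemxAl scalemxAr -linearZ /= /V -mulmxBl -mulmxBr -mulmxDl -mulmxDr -linearB -linearD /=.
  by congr (adjmx P *m diag_mx _ *m P); apply/rowP => l; rewrite !mxE.
have sX : sC ^+ 2 = Complex (s ^+ 2) 0 by rewrite -[sC]/(real_complex R s) -rmorphXn.
(* Eigenvalues of a state lie in [0, 1], hence |s r| <= 1 and the scalar Taylor bound applies. *)
have hq l : `|q 0 l| <= 2 * sC ^+ 2.
  have pl1 : p 0 l <= 1 by rewrite -p1 (bigD1 l) //= lerDl sumr_ge0.
  have ep : p 0 l = Complex (complex.Re (p 0 l)) 0 by exact: esym (RRe_real (ger0_real (p0 l))).
  set r := complex.Re (p 0 l) in ep *.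
  have r1 : r <= 1 by move: pl1; rewrite lecE => /andP[].
  have r0 : 0 <= r by move: (p0 l); rewrite lecE => /andP[].
  have rs : (s * r) ^+ 2 <= s ^+ 2 by rewrite exprMn ler_piMr ?sqr_ge0 // expr_le1.
  have -> : q 0 l = expi (s * r) - 1 + 'i * Complex (s * r) 0.
    rewrite mxE -/r ep -mulrA; congr (_ + 'i * _).
    by rewrite -[LHS](rmorphM (real_complex R)).
  have sr1 : `|s * r| <= 1.
    by rewrite -(@ler_pXn2r _ 2) ?nnegrE // expr1n real_normK ?num_real // (le_trans rs).
  apply: le_trans (expi_taylor sr1) _.
  by rewrite sX ler_wpM2l // lecR.
have s0 : 0 <= 2 * sC ^+ 2 by rewrite sX mulr_ge0 // ler0c sqr_ge0.
pose A k := expi_mx P p (k%:R * s) *t (1%:M : 'M[CC]_dB).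
have A0 : A 0%N = 1%:M by rewrite /A mul0r expi_mx0 // tensmx11.
have AS k : A k.+1 = A 1%N *m A k := expi_mx_tensS dB s p k PP.
have A1 : A 1%N = V *t 1%:M by rewrite /A mul1r.
have An : A n = UB by rewrite /A /UB ns -eU.
rewrite mxofD -An -(iter_conjmx sigmaC n A0 AS) A1 -opprB; apply: trboundN.
have -> : Complex ((1 + 13 * s ^+ 2) ^+ n - 1) 0 = (1 + 13 * sC ^+ 2) ^+ n - 1.
  rewrite -[LHS]/(real_complex R _) -[sC]/(real_complex R s).
  by rewrite rmorphB rmorphXn rmorphD rmorphM rmorphXn !rmorph1 rmorph_nat.
have hs1 : sC ^+ 2 <= 1 by rewrite sX lecR.
have hcs : cC ^+ 2 = 1 - sC ^+ 2.
  by rewrite sX -[cC]/(real_complex R c) -rmorphXn cs1 rmorphB rmorph1.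
have hcss : `|cC * sC - sC| <= sC ^+ 2.
  have -> : cC * sC - sC = Complex (c * s - s) 0.
    by rewrite -[cC]/(real_complex R c) -[sC]/(real_complex R s) -rmorphM -rmorphB.
  rewrite sX normc_def /= expr0n /= addr0 sqrtr_sqr lecR.
  exact: css.
have hQ : opbound (2 * sC ^+ 2) (V - 1%:M + ('i * sC) *: (adjmx P *m diag_mx p *m P)).
  by rewrite eQ; apply: opbound_conj_diag.
have hQ' : opbound (2 * sC ^+ 2) (adjmx (V - 1%:M + ('i * sC) *: (adjmx P *m diag_mx p *m P))).
  rewrite eQ adjmx_conj_diag; apply: (opbound_conj_diag PP s0) => l.
  by rewrite mxE norm_conjC; apply: hq.
rewrite /rhoC eP.
exact: (iter_swapstep_error PP p0 p1 (Complex_real s) hs1 hcs hcss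
  (opbound_expi_mx p s PP) (opbound_adj_expi_mx p s PP) hQ hQ' n sigma_bound).
Qed.

End LMRError.

(** * Restatement with the standard real operations *)

Section StdlibForm.
Local Open Scope R_scope.

Lemma lmr_kraus_is_channel dA c s n : c ^ 2 = 1 - s ^ 2 ->
  is_channel dA (dA * Nat.pow dA n) (lmr_kraus dA c s n).
Proof.
move=> h; have h2 : c * c + s * s = 1 by simpl in h; Lra.lra.
exact: lmr_kraus_channel h2.
Qed.

Lemma lmr_error_bound dA dB n c s t rho sigma U :
  density dA rho -> density (dA * dB) sigma -> Mexp_is dA (Mscale (mkC 0 (- t)) rho) U ->
  INR n * s = t -> s ^ 2 <= 1 -> 0 <= c -> c ^ 2 = 1 - s ^ 2 ->
  exists x, trnorm (dA * dB) (Msub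
     (Mmul (dA * dB) (Mmul (dA * dB) (kron dB dB U Mid) sigma) (Madj (kron dB dB U Mid)))
     (apply_lifted (dA * dB * Nat.pow dA n) dB (Nat.pow dA n) (lmr_kraus dA c s n)
        (kron (Nat.pow dA n) (Nat.pow dA n) sigma (tpow dA rho n)))) x /\
    x <= (1 + 13 * s ^ 2) ^ n - 1.
Proof.
move=> hr hs hU; rewrite INRE !RpowE => ns /RleP s1 /RleP c0 cs1.
have [x hx /RleP le] := lmr_error hr hs hU ns s1 c0 cs1.
have e13 : (13%:R)%R = IZR 13 by rewrite -INRE INR_IZR_INZ.
exists x; split; first exact: hx.
by rewrite e13 in le; exact: le.
Qed.

Lemma lmr_zero_steps dA dB c s t rho sigma U :
  density dA rho -> density (dA * dB) sigma -> Mexp_is dA (Mscale (mkC 0 (- t)) rho) U ->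
  exists x, trnorm (dA * dB) (Msub
     (Mmul (dA * dB) (Mmul (dA * dB) (kron dB dB U Mid) sigma) (Madj (kron dB dB U Mid)))
     (apply_lifted (dA * dB * Nat.pow dA 0) dB (Nat.pow dA 0) (lmr_kraus dA c s 0)
        (kron (Nat.pow dA 0) (Nat.pow dA 0) sigma (tpow dA rho 0)))) x /\ x <= 2.
Proof.
move=> hr hs hU; have [x hx /RleP le] := lmr_trivial_error c s hr hs hU (erefl 0%N).
by exists x.
Qed.

End StdlibForm.

End LMR.

(** * Choice of the number of copies *)

Theorem theorem1 :
  exists c : R, 0 < c /\
  forall (dA : nat) (t delta : R), 0 < delta ->
  exists (n : nat) (Ks : list Mat),
    INR n <= c * (1 + t ^ 2 / delta) /\
    is_channel dA (dA * dA ^ n) Ks /\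
    forall (dB : nat) (rho sigma U : Mat),
      density dA rho ->
      density (dA * dB) sigma ->
      Mexp_is dA (Mscale (mkC 0 (- t)) rho) U ->
      exists x : R,
        trnorm (dA * dB)
          (Msub
             (Mmul (dA * dB)
                (Mmul (dA * dB) (kron dB dB U Mid) sigma)
                (Madj (kron dB dB U Mid)))
             (apply_lifted (dA * dB * dA ^ n) dB (dA ^ n) Ks
                (kron (dA ^ n) (dA ^ n) sigma (tpow dA rho n))))
          x /\
        x / 2 <= delta.
Proof.
  (* 26 = 2 * 13: for n >= 26 t^2 / delta and delta < 1, 13 n s^2 = 13 t^2 / n <= delta / 2 < 1/2,
     so compounding applies and yields at most 26 n s^2 <= delta. *)
  exists 26. split; [lra|]. intros dA t delta hd.
  assert (t0 : 0 <= t ^ 2) by nra.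
  assert (q0 : 0 <= t ^ 2 / delta) by (apply Rle_mult_inv_pos; lra).
  destruct (Rle_dec 1 delta) as [d1 | d1].
  - (* Two states are always at trace distance at most 1. *)
    exists 0%nat, (LMR.lmr_kraus dA 1 0 0). split; [simpl; lra|]. split.
    { apply LMR.lmr_kraus_is_channel. ring. }
    intros dB rho sigma U hrho hsigma hU.
    destruct (LMR.lmr_zero_steps 1 0 hrho hsigma hU) as [x [hx le]].
    exists x. split; [exact hx | lra].
  - set (r := 26 * (t ^ 2 / delta)).
    (* [up r] lies strictly above [r] and is at most [r + 1]: the number of copies is positive even
       for t = 0, and the excess over [r] is absorbed by the 1 in the bound on n. *)
    destruct (archimed r) as [up1 up2].
    assert (upos : (0 <= up r)%Z) by (apply le_IZR; unfold r in *; lra).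
    set (n := Z.to_nat (up r)).
    assert (hn : INR n = IZR (up r)) by (unfold n; rewrite INR_IZR_INZ, Z2Nat.id; auto).
    rewrite <- hn in up1, up2.
    assert (n0 : 0 < INR n) by (unfold r in *; lra).
    set (s := t / INR n).
    assert (n1 : 1 <= INR n).
    { apply (le_INR 1). destruct n; [simpl in n0; lra | lia]. }
    assert (ns : INR n * s = t) by (unfold s; field; lra).
    assert (e1 : 26 * t ^ 2 <= INR n * delta).
    { assert (r * delta <= INR n * delta) by (apply Rmult_le_compat_r; lra).
      replace (r * delta) with (26 * t ^ 2) in H by (unfold r; field; lra). exact H. }
    assert (e2 : 26 * (INR n * s ^ 2) <= delta).
    { apply Rmult_le_reg_l with (INR n); [exact n0|].
      replace (INR n * (26 * (INR n * s ^ 2))) with (26 * (INR n * s) ^ 2) by ring.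
      rewrite ns. exact e1. }
    assert (s0 : 0 <= s ^ 2) by nra.
    (* From 26 n s^2 <= delta < 1 and n >= 1. *)
    assert (s1 : s ^ 2 <= 1) by nra.
    set (c := sqrt (1 - s ^ 2)).
    assert (c0 : 0 <= c) by apply sqrt_pos.
    assert (c2 : c ^ 2 = 1 - s ^ 2) by (unfold c; apply pow2_sqrt; lra).
    exists n, (LMR.lmr_kraus dA c s n). split; [unfold r in *; lra|]. split.
    { apply LMR.lmr_kraus_is_channel. exact c2. }
    intros dB rho sigma U hrho hsigma hU.
    destruct (LMR.lmr_error_bound hrho hsigma hU ns s1 c0 c2) as [x [hx le]].
    exists x. split; [exact hx|].
    pose proof (compound_bound (13 * s ^ 2) n ltac:(lra) ltac:(lra)). lra.
Qed.
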